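(* Let $f\in\mathbb{Q}[X]$ be an irreducible polynomial of degree $4$ with Galois group (over $\mathbb{Q}$) isomorphic to $S_4$, let $x$ be a root of $f$ in a splitting field of $f$ over $\mathbb{Q}$, and let $d$ be the discriminant of $f$. Then the extension $\mathbb{Q}(x,\sqrt{d})/\mathbb{Q}$ is a Hopf Galois extension of degree $8$ which is not almost classically Galois.
   Context: A finite extension of fields $L/k$ is called Hopf Galois if there exists a finite cocommutative $k$-Hopf algebra $H$ such that $L$ is an $H$-module algebra and the $k$-linear map $j: L\otimes_k H\to \operatorname{End}_k(L)$, $j(s\otimes h)(t)=s(ht)$ for $h\in H$, $s,t\in L$, is bijective. Let $L/k$ be a finite separable extension with Galois closure $\widetilde{L}/k$, $\Gamma=\operatorname{Gal}(\widetilde{L}/k)$, $\Gamma'=\operatorname{Gal}(\widetilde{L}/L)$, and let $\lambda:\Gamma\to\operatorname{Sym}(\Gamma/\Gamma')$ be the left translation action on left cosets. $L/k$ is called almost classically Galois if there is a regular (i.e. sharply transitive) subgroup $N$ of $\operatorname{Sym}(\Gamma/\Gamma')$ which is normalized by $\lambda(\Gamma)$ and contained in $\lambda(\Gamma)$; equivalently, $\Gamma'$ has a normal complement in $\Gamma$. *)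

(* Defs.v *)
From HB Require Import structures.
From mathcomp Require Import all_boot all_order all_algebra.
From mathcomp Require Import all_fingroup all_solvable all_field.

Set Implicit Arguments.
Unset Strict Implicit.
Unset Printing Implicit Defensive.

Import GRing.Theory.
Local Open Scope ring_scope.

(* The tensor product of finite-dimensional spaces is modelled by matrices of *)
(* coordinates in the bases e (x) e'; tens_liftE, tens_lift_linear and        *)
(* tens_ext are its universal property.                                       *)
Section Tensor.
Variable k : fieldType.

Definition tensor (U V : vectType k) := 'M[k]_(\dim {:U}, \dim {:V}).

Definition tens (U V : vectType k) (u : U) (v : V) : tensor U V :=
  \matrix_(i, j) (coord (vbasis {:U}) i u * coord (vbasis {:V}) j v).

Definition tens_lift (U V : vectType k) (W : lmodType k) (b : U -> V -> W)
    (t : tensor U V) : W :=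
  \sum_i \sum_j t i j *: b (vbasis {:U})`_i (vbasis {:V})`_j.

Lemma tens_lift_linear (U V : vectType k) (W : lmodType k) (b : U -> V -> W) :
  linear (tens_lift b).
Proof.
move=> a s t; rewrite /tens_lift scaler_sumr -big_split; apply: eq_bigr => i _.
rewrite /= scaler_sumr -big_split; apply: eq_bigr => j _.
by rewrite /= !mxE scalerDl scalerA.
Qed.

Lemma tens_liftE (U V : vectType k) (W : lmodType k) (b : U -> V -> W) u v :
    (forall v, linear (b^~ v)) -> (forall u, linear (b u)) ->
  tens_lift b (tens u v) = b u v.
Proof.
move=> bl br.
pose bL v := GRing.isLinear.Build k U W _ (b^~ v) (bl v).
pose bR u := GRing.isLinear.Build k V W _ (b u) (br u).
pose fL v : {linear U -> W} := HB.pack (b^~ v) (bL v).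
pose fR u : {linear V -> W} := HB.pack (b u) (bR u).
rewrite [in RHS](coord_vbasis (memvf u)) [in RHS](coord_vbasis (memvf v)).
rewrite -[RHS]/(fL _ _) linear_sum; apply: eq_bigr => i _.
rewrite linearZ /= -[b _ _]/(fR _ _) linear_sum scaler_sumr.
by apply: eq_bigr => j _; rewrite linearZ /= scalerA mxE.
Qed.

Lemma tens_ext (U V : vectType k) (W : lmodType k)
    (f g : {linear tensor U V -> W}) :
  (forall u v, f (tens u v) = g (tens u v)) -> f =1 g.
Proof.
move=> fg t.
have tE : t = \sum_i \sum_j
    t i j *: tens (vbasis {:U})`_i (vbasis {:V})`_j :> tensor U V.
  apply/matrixP=> i j; rewrite summxE (bigD1 i) //= summxE (bigD1 j) //=.
  have cE (X : vectType k) (p q : 'I_(\dim {:X})) :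
    coord (vbasis {:X}) p (vbasis {:X})`_q = (q == p)%:R.
    by rewrite coord_free // (basis_free (vbasisP _)).
  rewrite !mxE !cE !eqxx !mulr1 !big1 ?addr0 // => [i' ni | j' nj].
    by rewrite summxE big1 // => j' _; rewrite !mxE !cE (negPf ni) mul0r mulr0.
  by rewrite !mxE !cE (negPf nj) !mulr0.
rewrite tE !linear_sum; apply: eq_bigr => i _; rewrite !linear_sum.
by apply: eq_bigr => j _; rewrite !linearZ fg.
Qed.

Definition tens_map (U U' V V' : vectType k) (f : U -> U') (g : V -> V') :
    tensor U V -> tensor U' V' :=
  tens_lift (fun u v => tens (f u) (g v)).

Definition tens_swap (U V : vectType k) : tensor U V -> tensor V U :=
  tens_lift (fun u v => tens v u).

Definition tens_assoc (U V W : vectType k) :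
    tensor (tensor U V) W -> tensor U (tensor V W) :=
  tens_lift (fun t w => tens_lift (fun u v => tens u (tens v w)) t).

Definition tens_mul (A B : falgType k) (s t : tensor A B) : tensor A B :=
  tens_lift (fun a b => tens_lift (fun c d => tens (a * c) (b * d)) t) s.

End Tensor.

Record hopfAlgebra (k : fieldType) := HopfAlgebra {
  hopf_sort :> falgType k;
  comul : {linear hopf_sort -> tensor hopf_sort hopf_sort};
  counit : {linear hopf_sort -> k^o};
  antipode : {linear hopf_sort -> hopf_sort};
  comulA : forall h,
    tens_assoc (tens_map comul id (comul h)) = tens_map id comul (comul h);
  counitl : forall h, tens_lift (fun a b => counit a *: b) (comul h) = h;
  counitr : forall h, tens_lift (fun a b => counit b *: a) (comul h) = h;
  comul1 : comul 1 = tens 1 1;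
  comulM : forall g h, comul (g * h) = tens_mul (comul g) (comul h);
  counit1 : counit 1 = 1;
  counitM : forall g h, counit (g * h) = counit g * counit h;
  antipodel : forall h,
    tens_lift (fun a b => antipode a * b) (comul h) = counit h *: 1;
  antipoder : forall h,
    tens_lift (fun a b => a * antipode b) (comul h) = counit h *: 1
}.

Arguments comul {k} H : rename.
Arguments counit {k} H : rename.
Arguments antipode {k} H : rename.

Definition cocommutative (k : fieldType) (H : hopfAlgebra k) : Prop :=
  forall h : H, tens_swap (comul H h) = comul H h.

(* The linearity of act makes the action k-bilinear.                          *)
Definition is_module_algebra (k : fieldType) (H : hopfAlgebra k)
    (A : falgType k) (act : {linear H -> 'End(A)}) : Prop :=
  [/\ forall a, act 1 a = a,
      forall g h a, act (g * h) a = act g (act h a),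
      forall h, act h 1 = counit H h *: 1
    & forall h a b,
        act h (a * b) = tens_lift (fun g g' => act g a * act g' b) (comul H h)].

(* s (x) h |-> (t |-> s (h t))                                                *)
Definition hopf_galois_map (k : fieldType) (H : hopfAlgebra k)
    (L : fieldExtType k) (act : {linear H -> 'End(L)}) :
    tensor L H -> 'End(L) :=
  tens_lift (fun (s : L) (h : H) => linfun (fun t => s * act h t)).

Definition hopf_galois (k : fieldType) (L : fieldExtType k) : Prop :=
  exists (H : hopfAlgebra k) (act : {linear H -> 'End(L)}),
    [/\ cocommutative H, is_module_algebra act
      & bijective (hopf_galois_map act)].

(* In 'Gal(K / k) the product g * h is h \o g as a composition of functions   *)
(* (galM), so the coset {g \o h | h in H} is H :* g, and composing with g on  *)
(* the left is right multiplication by g. Hence the left cosets and left      *)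
(* translations of automorphisms appear below as rcosets and 'Rs.             *)
Section AlmostClassical.
Variable gT : finGroupType.
Local Open Scope group_scope.

Definition translation (G H : {group gT}) (g : gT) : {perm {set gT}} :=
  restr_perm (rcosets H G) (actperm 'Rs g).

Definition sharply_transitive (T : finType) (N : {set {perm T}}) (S : {set T})
    : Prop :=
  {in S &, forall x y, exists! p, p \in N /\ p x = y}.

Definition almost_classical_pair (G H : {group gT}) : Prop :=
  exists N : {group {perm {set gT}}},
    [/\ N \subset perm.Sym (rcosets H G),
        sharply_transitive N (rcosets H G),
        translation G H @: G \subset 'N(N)
      & N \subset translation G H @: G].

End AlmostClassical.

Definition is_galois_closure (k : fieldType) (M : splittingFieldType k)
    (E K : {subfield M}) : Prop :=
  [/\ galois 1 K, (E <= K)%VS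
    & forall K' : {subfield M}, galois 1 K' -> (E <= K')%VS -> (K <= K')%VS].

(* As M is normal over k, it contains the Galois closure of each of its       *)
(* separable subextensions.                                                   *)
Definition almost_classically_galois (k : fieldType) (M : splittingFieldType k)
    (E : {subfield M}) : Prop :=
  exists2 K : {subfield M}, is_galois_closure E K
    & almost_classical_pair 'Gal(K / 1) 'Gal(K / E).

(* For f = a (X - r_1) ... (X - r_n) this is a^(2n-2) prod_(i < j) (r_i - r_j)^2. *)
(* In characteristic p the degree of f^`() may drop and the formula would fail.  *)
Definition discriminant (F : numFieldType) (f : {poly F}) : F :=
  let n := (size f).-1 in
  (-1) ^+ 'C(n, 2) * (lead_coef f)^-1 * resultant f f^`().

(* Main.v *)
From HB Require Import structures.
Require Import Defs.
From mathcomp Require Import all_boot all_order all_algebra.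
From mathcomp Require Import all_fingroup all_solvable all_field.
From mathcomp Require Import ring.

(* Let G = Gal(M/Q), which permutes the four roots of f as S_4; index them by *)
(* the plane (Z/2)^2 with x at the origin. The translations form the normal   *)
(* Klein subgroup V, and t, exchanging the two coordinates, fixes x and       *)
(* negates sqrt d, because d is lead(f)^6 times the squared Vandermonde       *)
(* product of the roots.                                                      *)
(*                                                                            *)
(* Put N = (Z/2)^2 x Z/2, with G acting on N through its conjugation action   *)
(* on V. The eight maps phi(a, c) = (translation by a) o t^c are a complement *)
(* of the order 3 group Gal(M/E), so they restrict to the eight embeddings of *)
(* E. The M-linear combinations of the phi(n) whose coefficients are          *)
(* G-equivariant form a Q-algebra H = M[N]^G, which preserves E because       *)
(* Gal(M/E) permutes these embeddings as it permutes N. Galois descent gives  *)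
(* M (x) H = M[N], whence the Hopf structure of H and the bijectivity of      *)
(* E (x) H -> End(E).                                                         *)
(*                                                                            *)
(* If E were almost classically Galois, the regular group N' in the           *)
(* translation group of G/C, C = Gal(M/E), would be a normal Sylow            *)
(* 2-subgroup, hence contain all involutions; these generate S_4, so          *)
(* sharp transitivity would make C act trivially, i.e., C normal in S_4.      *)

(** The maps phi(n) form a Sylow 2-subgroup of S_4. It complements Gal(M/E), which yields a Hopf
    Galois structure ([greither_pareigis_descent]) once its group law is retwisted into that of N;
    but it is not normal, and no normal complement exists ([almost_classical_pair_normal]).

    Descent is done in coordinates. An element h of H is known by its coefficients c n h in M, and
    by [equivariant_independent] these are independent over M, so identities in tensor powers of H
    may be checked in M[N] ([tens_pair_inj]). There the coproduct is diagonal, and the Hopf axioms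
    collected in [group_form] become statements about N. [equivariant_dim] and [dual_basis] supply
    the dimension of H and its coproduct. The Galois map is injective by [phi_independent], hence
    bijective by dimension.

    [quartic_compositum] treats an abstract quartic whose roots are indexed by the plane;
    [resultant_deriv_quartic] makes sqrt d a nonzero rational multiple of the Vandermonde
    product. *)

Set Implicit Arguments.
Unset Strict Implicit.
Unset Printing Implicit Defensive.

Import GRing.Theory Num.Theory.
Local Open Scope ring_scope.

(** * Tensor products *)

Section TensorTheory.
Variable k : fieldType.
Implicit Types U V : vectType k.

Lemma tens_linear_l U V (v : V) : linear (fun u : U => tens u v).
Proof. by move=> a u u'; apply/matrixP=> i j; rewrite !mxE linearP mulrDl mulrA. Qed.

Lemma tens_linear_r U V (u : U) : linear (fun v : V => tens u v).
Proof. by move=> a v v'; apply/matrixP=> i j; rewrite !mxE linearP mulrDr mulrCA. Qed.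

HB.instance Definition _ U V (W : lmodType k) (b : U -> V -> W) :=
  GRing.isLinear.Build k (tensor U V) W _ (tens_lift b) (tens_lift_linear b).

(** Pure tensors span additively, since a scalar can be moved into the left factor. *)
Lemma tens_ind U V (P : tensor U V -> Prop) :
    P 0 -> (forall s t, P s -> P t -> P (s + t)) ->
    (forall u v, P (tens u v)) ->
  forall t, P t.
Proof.
move=> P0 PD Pt t.
have -> : t = \sum_i \sum_j
    tens (t i j *: (vbasis {:U})`_i) (vbasis {:V})`_j.
  have tensK u v : tens_lift (@tens k U V) (tens u v) = tens u v.
    rewrite tens_liftE // => w; [exact: tens_linear_l | exact: tens_linear_r].
  rewrite [LHS](@tens_ext k U V _ idfun (tens_lift (@tens k U V)))
    ; last by move=> u v; exact: esym (tensK u v).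
  apply: eq_bigr => i _; apply: eq_bigr => j _.
  by apply/matrixP=> p q; rewrite !mxE linearZ /= mulrA.
by apply: (big_ind P) => // i _; apply: (big_ind P).
Qed.

End TensorTheory.

Section TensorAlgebra.
Variable k : fieldType.

Lemma tens_mul_linear_r (A B : falgType k) (s : tensor A B) :
  linear (tens_mul s).
Proof.
pose mul a b (t : tensor A B) := tens_lift (fun c d => tens (a * c) (b * d)) t.
have mul_lin a b : linear (mul a b) by exact: tens_lift_linear.
have mulE t : tens_mul s t = \sum_i \sum_j
    s i j *: mul (vbasis {:A})`_i (vbasis {:B})`_j t by [].
move=> x y z; rewrite !mulE scaler_sumr -big_split.
apply: eq_bigr => i _; rewrite /= scaler_sumr -big_split.
by apply: eq_bigr => j _; rewrite /= mul_lin scalerDr !scalerA mulrC.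
Qed.

Lemma tens_mulE (A B : falgType k) (a a' : A) (b b' : B) :
  tens_mul (tens a b) (tens a' b') = tens (a * a') (b * b').
Proof.
have lin a1 b1 : tens_lift (fun (c1 : A) (d1 : B) => tens (a1 * c1) (b1 * d1))
    (tens a' b') = tens (a1 * a') (b1 * b').
  rewrite tens_liftE => [|w|w] => [//|x y z|x y z].
    by rewrite mulrDr -scalerAr tens_linear_l.
  by rewrite mulrDr -scalerAr tens_linear_r.
rewrite /tens_mul tens_liftE ?lin // => [w|w] x y z; rewrite !lin.
  by rewrite mulrDl -scalerAl tens_linear_l.
by rewrite mulrDl -scalerAl tens_linear_r.
Qed.

End TensorAlgebra.

Section TensorPairing.
Variables (k : fieldType) (M : fieldExtType k).
Implicit Types U V W : vectType k.

(** Such forms, for a and b running over families, are the coordinates in which tensors are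
    compared. *)
Definition tens_pair U V (a : {linear U -> M}) (b : {linear V -> M}) :
    {linear tensor U V -> M} :=
  tens_lift (fun u v => a u * b v : M).

Lemma tens_pairE U V (a : {linear U -> M}) (b : {linear V -> M}) u v :
  tens_pair a b (tens u v) = a u * b v.
Proof.
rewrite /tens_pair /= tens_liftE // => [w|w] x y z; rewrite linearP.
  by rewrite mulrDl scalerAl.
by rewrite mulrDr scalerAr.
Qed.

(* The vectors (a i e_p)_i attached to the k-basis e of U are independent     *)
(* over M, i.e., M (x) U -> M^I is injective.                                 *)
Definition M_independent (I : Type) U (a : I -> {linear U -> M}) :=
  forall x : 'I_(\dim {:U}) -> M,
    (forall i, \sum_p x p * a i (vbasis {:U})`_p = 0) -> forall p, x p = 0.

Lemma M_independent_inj (I : Type) U (a : I -> {linear U -> M}) u :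
  M_independent a -> (forall i, a i u = 0) -> u = 0.
Proof.
move=> a_free a0; rewrite (coord_vbasis (memvf u)) big1 // => p _.
suff /(_ p)/eqP : forall p, (coord (vbasis {:U}) p u)%:A = 0 :> M.
  by rewrite scaler_eq0 oner_eq0 orbF => /eqP ->; rewrite scale0r.
apply: (a_free (fun p => (coord (vbasis {:U}) p u)%:A)) => i.
rewrite -[RHS](a0 i) [in RHS](coord_vbasis (memvf u)) linear_sum.
by apply: eq_bigr => q _; rewrite linearZ /= mulr_algl.
Qed.

(** Write t as the sum of e_p (x) v_p. Independence of a over M kills every b j (v_p), and then
    injectivity of b kills v_p. The right factor only has to be injective over k, so it may be a
    tensor square or the inclusion of E in M. *)
Lemma tens_pair_inj (I J : Type) U V (a : I -> {linear U -> M})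
    (b : J -> {linear V -> M}) t :
    M_independent a -> (forall v, (forall j, b j v = 0) -> v = 0) ->
  (forall i j, tens_pair (a i) (b j) t = 0) -> t = 0.
Proof.
move=> a_free b_inj t0; apply/matrixP=> p q; rewrite mxE.
pose v p := \sum_q t p q *: (vbasis {:V})`_q.
suff /(congr1 (coord (vbasis {:V}) q)) : v p = 0.
  by rewrite linear0 coord_sum_free // (basis_free (vbasisP _)).
apply: b_inj => j; apply: (a_free (fun p => b j (v p))) => i.
rewrite -[RHS](t0 i j) /tens_pair /= /tens_lift; apply: eq_bigr => p' _.
rewrite linear_sum mulr_suml; apply: eq_bigr => q' _.
by rewrite linearZ /= -scalerAl mulrC.
Qed.

Lemma tens_pair_map U U' V V' (f : {linear U -> U'}) (g : {linear V -> V'})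
    (a : {linear U' -> M}) (b : {linear V' -> M}) t :
  tens_pair a b (tens_map f g t) = tens_pair (a \o f) (b \o g) t.
Proof.
rewrite /tens_map; elim/tens_ind: t => [|s t IHs IHt|u v].
- by rewrite !linear0.
- by rewrite !linearD /= IHs IHt.
rewrite tens_liftE => [|w|w]; first by rewrite !tens_pairE.
  by move=> x y z; rewrite linearP tens_linear_l.
by move=> x y z; rewrite linearP tens_linear_r.
Qed.

Lemma tens_pair_assoc U V W (a : {linear U -> M}) (b : {linear V -> M})
    (c : {linear W -> M}) t :
  tens_pair a (tens_pair b c) (tens_assoc t) = tens_pair (tens_pair a b) c t.
Proof.
have lin_in w : linear (fun s : tensor U V =>
    tens_lift (fun u v => tens u (tens v w)) s).
  exact: tens_lift_linear.
rewrite /tens_assoc; elim/tens_ind: t => [|s t IHs IHt|s w].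
- by rewrite !linear0.
- by rewrite !linearD /= IHs IHt.
rewrite tens_pairE tens_liftE => [||{w}s].
- elim/tens_ind: s => [|s t IHs IHt|u v].
  + by rewrite !linear0 mul0r.
  + by rewrite !linearD /= mulrDl IHs IHt.
  rewrite tens_liftE ?tens_pairE ?mulrA // => x y z z'; first exact: tens_linear_l.
  by rewrite tens_linear_l tens_linear_r.
- exact: lin_in.
move=> x y z; rewrite /tens_lift scaler_sumr -big_split.
apply: eq_bigr => i _; rewrite /= scaler_sumr -big_split.
apply: eq_bigr => j _.
by rewrite /= !tens_linear_r scalerDr !scalerA [x * _]mulrC.
Qed.

Lemma tens_pair_swap U V (a : {linear U -> M}) (b : {linear V -> M}) t :
  tens_pair b a (tens_swap t) = tens_pair a b t.
Proof.
rewrite /tens_swap; elim/tens_ind: t => [|s t IHs IHt|u v].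
- by rewrite !linear0.
- by rewrite !linearD /= IHs IHt.
rewrite tens_liftE => [|w|w]; first by rewrite !tens_pairE mulrC.
  exact: tens_linear_r.
exact: tens_linear_l.
Qed.

End TensorPairing.

(** * Forms of group algebras *)

Section GroupForm.
Variables (k : fieldType) (M : fieldExtType k) (H : falgType k).
Variables (N : finZmodType) (c : N -> {linear H -> M}).

(** The coproduct of h must be the sum of c n h [n] (x) [n]. A linear section of the coordinate map
    over its image chooses the preimages linearly in h. *)
Lemma diag_comul :
    (forall h, exists t : tensor H H,
      forall n m, tens_pair (c n) (c m) t = (n == m)%:R * c n h) ->
  exists D : {linear H -> tensor H H},
  forall h n m, tens_pair (c n) (c m) (D h) = (n == m)%:R * c n h.
Proof.
move=> diag; pose F t : {ffun N * N -> M} := [ffun p => tens_pair (c p.1) (c p.2) t].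
have F_lin : linear F by move=> a s t; apply/ffunP=> p; rewrite !ffunE linearP.
pose FL : {linear tensor H H -> {ffun N * N -> M}} :=
  HB.pack F (GRing.isLinear.Build k _ _ _ F F_lin).
pose G h : {ffun N * N -> M} := [ffun p => (p.1 == p.2)%:R * c p.1 h].
have G_lin : linear G.
  by move=> a s t; apply/ffunP=> p; rewrite !ffunE linearP mulrDr scalerAr.
pose GL : {linear H -> {ffun N * N -> M}} :=
  HB.pack G (GRing.isLinear.Build k _ _ _ G G_lin).
exists ((linfun FL)^-1 \o linfun GL)%VF => h n m.
have: linfun FL (((linfun FL)^-1 \o linfun GL)%VF h) = G h.
  rewrite comp_lfunE [linfun GL h]lfunE limg_lfunVK //.
  have [t tE] := diag h.
  have -> : GL h = linfun FL t.
    by rewrite lfunE; apply/ffunP=> -[i j]; rewrite !ffunE tE.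
  exact: memv_img (memvf _).
by rewrite (lfunE FL) => /ffunP/(_ (n, m)); rewrite !ffunE.
Qed.


(* c n h is the coefficient of n when h is viewed in M[N].                    *)
Hypothesis addnn : forall n : N, n + n = 0.
Hypothesis c_free : M_independent c.
Hypothesis c1 : forall n, c n 1 = (n == 0)%:R.
Hypothesis cM : forall g h n, c n (g * h) = \sum_m c m g * c (n - m) h.
Variables (D : {linear H -> tensor H H}) (e : {linear H -> k^o}).
Hypothesis cD : forall h n m, tens_pair (c n) (c m) (D h) = (n == m)%:R * c n h.
Hypothesis ce : forall h, (e h)%:A = \sum_n c n h.

Let c_inj g h : (forall n, c n g = c n h) -> g = h.
Proof.
move=> cgh; apply/eqP; rewrite -subr_eq0; apply/eqP.
by apply: (M_independent_inj c_free) => n; rewrite linearB /= cgh subrr.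
Qed.

Let c2_eq0 (t : tensor H H) :
  (forall n m, tens_pair (c n) (c m) t = 0) -> t = 0.
Proof. by apply: tens_pair_inj => // v; apply: M_independent_inj. Qed.

Let c2_inj (s t : tensor H H) :
  (forall n m, tens_pair (c n) (c m) s = tens_pair (c n) (c m) t) -> s = t.
Proof.
move=> cst; apply/eqP; rewrite -subr_eq0; apply/eqP; apply: c2_eq0 => n m.
by rewrite linearB /= cst subrr.
Qed.

Let c3_inj (s t : tensor H (tensor H H)) :
    (forall n m l, tens_pair (c n) (tens_pair (c m) (c l)) s =
                   tens_pair (c n) (tens_pair (c m) (c l)) t) -> s = t.
Proof.
move=> cst; apply/eqP; rewrite -subr_eq0; apply/eqP.
apply: (@tens_pair_inj _ _ _ _ _ _ c
          (fun p : N * N => tens_pair (c p.1) (c p.2))) => //.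
  by move=> v v0; apply: c2_eq0 => n m; apply: (v0 (n, m)).
by move=> n [m l]; rewrite linearB /= cst subrr.
Qed.


(** In coordinates both sides are c n h if n = m = l, and 0 otherwise. *)
Fact form_comulA h :
  tens_assoc (tens_map D id (D h)) = tens_map id D (D h).
Proof.
apply: c3_inj => n m l; rewrite tens_pair_assoc -/(@idfun H) !tens_pair_map.
have -> : forall t, tens_pair (tens_pair (c n) (c m) \o D) (c l \o idfun) t =
    (n == m)%:R * tens_pair (c n) (c l) t.
  elim/tens_ind=> [|s t IHs IHt|u v]; first by rewrite !linear0 mulr0.
    by rewrite !linearD /= IHs IHt mulrDr.
  by rewrite !tens_pairE /= cD mulrA.
have -> : forall t, tens_pair (c n \o idfun) (tens_pair (c m) (c l) \o D) t =
    (m == l)%:R * tens_pair (c n) (c m) t.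
  elim/tens_ind=> [|s t IHs IHt|u v]; first by rewrite !linear0 mulr0.
    by rewrite !linearD /= IHs IHt mulrDr.
  by rewrite !tens_pairE /= cD mulrCA.
rewrite !cD; have [->|] := eqVneq n m; first by rewrite !mul1r.
by rewrite !mul0r mulr0.
Qed.

Fact form_counitl h : tens_lift (fun a b => e a *: b) (D h) = h.
Proof.
apply: c_inj => m.
have -> : forall t, c m (tens_lift (fun a b => e a *: b) t) =
    \sum_n tens_pair (c n) (c m) t.
  elim/tens_ind=> [|s t IHs IHt|u v].
  - by rewrite !linear0 big1 // => n _; rewrite linear0.
  - by rewrite !linearD IHs IHt -big_split; apply: eq_bigr => n _; rewrite linearD.
  rewrite tens_liftE => [|w|w] => [|x y z|x y z].
  - rewrite linearZ /= -mulr_algl ce mulr_suml.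
    by apply: eq_bigr => n _; rewrite tens_pairE.
  - by rewrite linearP scalerDl scalerA.
  by rewrite scalerDr !scalerA mulrC.
rewrite (bigD1 m) //= cD eqxx mul1r big1 ?addr0 // => n /negPf nm.
by rewrite cD nm mul0r.
Qed.

Lemma form_cocomm h : tens_swap (D h) = D h.
Proof.
apply: c2_inj => n m; rewrite tens_pair_swap !cD eq_sym.
by have [->|] := eqVneq n m; rewrite ?mul0r.
Qed.

Fact form_counitr h : tens_lift (fun a b => e b *: a) (D h) = h.
Proof.
apply: c_inj => m.
have -> : forall t, c m (tens_lift (fun a b => e b *: a) t) =
    \sum_n tens_pair (c m) (c n) t.
  elim/tens_ind=> [|s t IHs IHt|u v].
  - by rewrite !linear0 big1 // => n _; rewrite linear0.
  - by rewrite !linearD IHs IHt -big_split; apply: eq_bigr => n _; rewrite linearD.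
  rewrite tens_liftE => [|w|w] => [|x y z|x y z].
  - rewrite linearZ /= -mulr_algr ce mulr_sumr.
    by apply: eq_bigr => n _; rewrite tens_pairE.
  - by rewrite scalerDr !scalerA mulrC.
  by rewrite linearP scalerDl scalerA.
rewrite (bigD1 m) //= cD eqxx mul1r big1 ?addr0 // => n nm.
by rewrite cD eq_sym (negPf nm) mul0r.
Qed.

Fact form_comul1 : D 1 = tens 1 1.
Proof.
apply: c2_inj => n m; rewrite cD tens_pairE !c1.
have [->|] := eqVneq n m; first by case: eqP; rewrite ?mulr1 ?mulr0.
by have [-> | ] := eqVneq n 0; rewrite ?mul0r // eq_sym => /negPf ->; rewrite mulr0.
Qed.

Fact form_comulM g h : D (g * h) = tens_mul (D g) (D h).
Proof.
apply: c2_inj => n m.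
have -> : forall s t, tens_pair (c n) (c m) (tens_mul s t) =
    \sum_a \sum_b tens_pair (c a) (c b) s * tens_pair (c (n - a)) (c (m - b)) t.
  elim/tens_ind=> [|s s' IHs IHs'|u v] t.
  - rewrite /tens_mul !linear0 big1 // => a _; rewrite big1 // => b _.
    by rewrite linear0 mul0r.
  - rewrite /tens_mul !linearD /= IHs IHs' -big_split; apply: eq_bigr => a _.
    rewrite -big_split; apply: eq_bigr => b _.
    by rewrite linearD mulrDl.
  pose mul_uv : {linear tensor H H -> tensor H H} := HB.pack (tens_mul (tens u v))
    (GRing.isLinear.Build k _ _ _ _ (tens_mul_linear_r (tens u v))).
  rewrite -[tens_mul _ t]/(mul_uv t).
  elim/tens_ind: t => [|t t' IHt IHt'|u' v'].
  - rewrite !linear0 big1 // => a _; rewrite big1 // => b _.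
    by rewrite linear0 mulr0.
  - rewrite !linearD /= IHt IHt' -big_split; apply: eq_bigr => a _.
    rewrite -big_split; apply: eq_bigr => b _.
    by rewrite linearD mulrDr.
  rewrite /= tens_mulE tens_pairE !cM big_distrlr; apply: eq_bigr => a _.
  by apply: eq_bigr => b _; rewrite !tens_pairE mulrACA.
rewrite cD cM mulr_sumr; apply: eq_bigr => a _.
rewrite (bigD1 a) //= big1 ?addr0 => [|b /negPf ab]; last first.
  by rewrite cD eq_sym ab !mul0r.
rewrite !cD eqxx mul1r mulrCA; congr (_ * (_ * _)).
by rewrite (inj_eq (addIr _)).
Qed.

Let in_alg_inj : injective (GRing.in_alg M).
Proof. exact: fmorph_inj. Qed.

Fact form_counit1 : e 1 = 1.
Proof.
apply: in_alg_inj; rewrite /= ce (bigD1 0) //= c1 eqxx big1 ?addr0 ?scale1r //.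
by move=> n /negPf n0; rewrite c1 n0.
Qed.

Fact form_counitM g h : e (g * h) = e g * e h.
Proof.
apply: in_alg_inj; rewrite rmorphM /= !ce.
under eq_bigr do rewrite cM.
rewrite exchange_big mulr_suml; apply: eq_bigr => m _ /=.
by rewrite -mulr_sumr; congr (_ * _); rewrite [RHS](reindex_inj (addIr (- m))).
Qed.

(** The diagonal coproduct is supported on pairs (m, m), whose sum m + m is 0, so only the
    coefficient at l = 0 survives. *)
Fact form_antipode h : tens_lift (fun a b : H => a * b) (D h) = e h *: 1.
Proof.
apply: c_inj => l.
have -> : forall t, c l (tens_lift (fun a b : H => a * b) t) =
    \sum_m tens_pair (c m) (c (l - m)) t.
  elim/tens_ind=> [|s t IHs IHt|u v].
  - by rewrite !linear0 big1 // => n _; rewrite linear0.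
  - by rewrite !linearD IHs IHt -big_split; apply: eq_bigr => n _; rewrite linearD.
  rewrite tens_liftE => [|w|w] => [|x y z|x y z].
  - by rewrite cM; apply: eq_bigr => n _; rewrite tens_pairE.
  - by rewrite mulrDl scalerAl.
  by rewrite mulrDr scalerAr.
rewrite linearZ /= c1 -mulr_algl ce mulr_suml; apply: eq_bigr => m _.
by rewrite cD mulrC eq_sym subr_eq addnn.
Qed.

(* The antipode of M[N] is n |-> - n, which is the identity here.             *)
Definition group_form : hopfAlgebra k :=
  @HopfAlgebra k H D e idfun form_comulA form_counitl form_counitr form_comul1
    form_comulM form_counit1 form_counitM form_antipode form_antipode.

End GroupForm.

(** * Galois descent *)

Section Descent.
Variables (k : fieldType) (M : splittingFieldType k).
Hypothesis galM1 : galois 1 {:M}.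
Local Notation G := (gal_of {:M}).

Lemma galM_fun (g h : G) a : (g * h)%g a = h (g a).
Proof. by rewrite galM ?memvf. Qed.

Lemma gal_fixed_in1 a : (forall g : G, g a = a) -> a \in 1%VS.
Proof.
move=> fix_a; rewrite -(galois_fixedField galM1).
by apply/fixedFieldP => [|g _]; rewrite ?memvf.
Qed.

(** The hypothesis is a linear relation between the automorphisms g with coefficients g x, so
    Dedekind independence applies; g = 1 gives x. *)
Lemma trace_nondegenerate x : (forall u, \sum_(g : G) g (u * x) = 0) -> x = 0.
Proof.
move=> tr0; rewrite -(gal_id {:M} x).
apply: (@gal_independent _ _ _ xpredT (fun g : G => g x)) => // u _.
by rewrite -[RHS](tr0 u); apply: eq_bigr => g _; rewrite rmorphM mulrC.
Qed.

Lemma trace_in1 u : \sum_(g : G) g u \in 1%VS.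
Proof.
apply: gal_fixed_in1 => h; rewrite rmorph_sum [RHS](reindex_inj (mulIg h)).
by apply: eq_bigr => g _; rewrite galM_fun.
Qed.

Variables (N : finType) (actN : G -> N -> N).
Hypothesis actN1 : forall n, actN 1%g n = n.
Hypothesis actNM : forall g h n, actN (g * h)%g n = actN h (actN g n).

Definition equivariant (s : N -> M) := forall (g : G) n, g (s n) = s (actN g n).

Variables (U : vectType k) (c : N -> {linear U -> M}).
Hypothesis c_equiv : forall u, equivariant (c^~ u).
Hypothesis c_inj : forall u, (forall n, c n u = 0) -> u = 0.

Let c_gal u (g : G) n : g (c n u) = c (actN g n) u.
Proof. exact: c_equiv. Qed.

(* Traces of u * (a relation over M) are relations over k, hence trivial.     *)
Lemma equivariant_independent : M_independent c.
Proof.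
move=> x x0 p; apply: trace_nondegenerate => u.
have /fin_all_exists[a aE] q : exists b : k, \sum_(g : G) g (u * x q) = b%:A.
  by have /vlineP[b ->] := trace_in1 (u * x q); exists b.
have a0 : \sum_q a q *: (vbasis {:U})`_q = 0.
  apply: c_inj => n; rewrite linear_sum.
  under eq_bigr do rewrite linearZ /= -mulr_algl -aE mulr_suml.
  rewrite exchange_big big1 // => g _; transitivity (g u * g 0).
    rewrite -[in RHS](x0 (actN g^-1%g n)) rmorph_sum mulr_sumr.
    apply: eq_bigr => q _; rewrite !rmorphM /= c_gal -actNM mulVg actN1.
    by rewrite mulrA.
  by rewrite rmorph0 mulr0.
rewrite aE; have := congr1 (coord (vbasis {:U}) p) a0.
by rewrite coord_sum_free ?(basis_free (vbasisP _)) // linear0 => ->; rewrite scale0r.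
Qed.

Hypothesis c_im : forall s, equivariant s -> exists u, forall n, c n u = s n.

Local Notation d := (\dim {:U}).

Let P : 'M[M]_(d, #|N|) := \matrix_(p, n) c (enum_val n) (vbasis {:U})`_p.

Let P_free : row_free P.
Proof.
apply: inj_row_free => v vP; apply/rowP=> p; rewrite mxE.
apply: (equivariant_independent (x := v 0)) => n.
transitivity ((v *m P) 0 (enum_rank n)); last by rewrite vP mxE.
by rewrite mxE; apply: eq_bigr => q _; rewrite mxE enum_rankK.
Qed.

(* A vector orthogonal to the orbit sums of u [n], for all u in M, is 0 by    *)
(* independence of automorphisms.                                             *)
Let P_full : row_full P.
Proof.
rewrite /row_full -mxrank_tr -/(row_free P^T).
apply: inj_row_free => v vP; apply/rowP=> i; rewrite mxE.
pose y n := v 0 (enum_rank n).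
have y0 s : equivariant s -> \sum_n s n * y n = 0.
  move=> /c_im[u cu].
  rewrite (reindex_onto enum_val enum_rank) => [|n _]; last exact: enum_rankK.
  under eq_bigl do rewrite enum_valK eqxx.
  rewrite (coord_vbasis (memvf u)) in cu.
  transitivity (\sum_(p < d) (v *m P^T) 0 p * (coord (vbasis {:U}) p u)%:A); last first.
    by rewrite big1 // => p _; rewrite vP mxE mul0r.
  under [RHS]eq_bigr do rewrite mxE mulr_suml.
  rewrite exchange_big; apply: eq_bigr => j _.
  rewrite /y enum_valK -cu linear_sum mulr_suml; apply: eq_bigr => p _.
  by rewrite !mxE linearZ /= -mulrA mulr_algr mulrC.
pose n := enum_val i.
have yg (g : G) : y (actN g n) = 0.
  apply: (@gal_independent _ _ _ xpredT (fun g : G => y (actN g n))) => // u _.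
  pose s m := \sum_(g : G | actN g n == m) g u.
  have s_equiv : equivariant s.
    move=> h m; rewrite /s rmorph_sum [RHS](reindex_inj (mulIg h)).
    apply: eq_big => [g'|g' _]; last by rewrite galM_fun.
    rewrite actNM (can_eq (g := actN h^-1%g)) // => l.
    by rewrite -actNM mulgV actN1.
  rewrite -[RHS](y0 s s_equiv).
  rewrite (partition_big (fun g : G => actN g n) xpredT) //=.
  apply: eq_bigr => m _; rewrite mulr_suml; apply: eq_bigr => g' /eqP <-.
  by rewrite mulrC.
by have := yg 1%g; rewrite actN1 /y /n enum_valK.
Qed.

(** [P] is the matrix of M (x) U -> M^N, which is thus an isomorphism. *)
Lemma equivariant_dim : \dim {:U} = #|N|.
Proof. by rewrite -(eqP P_free) (eqP P_full). Qed.

(* P^T (P P^T)^-1 P = 1, and P P^T has entries in k by G-invariance.          *)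
Lemma dual_basis : exists t : tensor U U,
  forall n m, tens_pair (c n) (c m) t = (n == m)%:R.
Proof.
have [Q PQ] := row_freeP P_free; have [Q' Q'P] := row_fullP P_full.
have QP : Q *m P = 1%:M by rewrite -[Q]mul1mx -Q'P -(mulmxA Q') PQ mulmx1.
have /fin_all_exists[T TE] (p : 'I_d) : exists a : 'I_d -> k, forall q,
    (P *m P^T) p q = (a q)%:A.
  suff T_in1 q : (P *m P^T) p q \in 1%VS.
    have /fin_all_exists[a aE] q : exists b : k, (P *m P^T) p q = b%:A.
      by have /vlineP[b ->] := T_in1 q; exists b.
    by exists a.
  apply: gal_fixed_in1 => g; rewrite mxE.
  rewrite (reindex_onto enum_rank enum_val) => [|i _]; last exact: enum_valK.
  under eq_bigl do rewrite enum_rankK eqxx.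
  have actN_inj : injective (actN g).
    by apply: (can_inj (g := actN g^-1%g)) => l; rewrite -actNM mulgV actN1.
  rewrite rmorph_sum [RHS](reindex_inj actN_inj); apply: eq_bigr => n _.
  by rewrite !mxE rmorphM /= !enum_rankK !c_gal.
pose T0 := \matrix_(p, q) T p q.
have T0E : map_mx (GRing.in_alg M) T0 = P *m P^T.
  by apply/matrixP=> p q; rewrite TE !mxE.
have TQ : P *m P^T *m (Q^T *m Q) = 1%:M.
  by rewrite -mulmxA (mulmxA P^T) -trmx_mul QP trmx1 mul1mx.
have uT : P *m P^T \in unitmx by case: (mulmx1_unit TQ).
exists (invmx T0) => n m.
transitivity ((P^T *m invmx (P *m P^T) *m P) (enum_rank n) (enum_rank m)).
  rewrite -T0E -map_invmx /tens_pair /= /tens_lift mxE exchange_big.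
  apply: eq_bigr => q _; rewrite mxE mulr_suml; apply: eq_bigr => p _.
  by rewrite !mxE !enum_rankK -mulr_algl mulrCA mulrA.
have -> : invmx (P *m P^T) = Q^T *m Q.
  by rewrite -[RHS]mul1mx -(mulVmx uT) -mulmxA TQ mulmx1.
rewrite mulmxA -trmx_mul QP trmx1 mul1mx QP mxE.
by rewrite (inj_eq enum_rank_inj).
Qed.

End Descent.

Lemma linfun_linearE (k : fieldType) (U V : vectType k) (f : U -> V) :
  linear f -> linfun f =1 f.
Proof.
move=> f_lin; pose F : {linear U -> V} :=
  HB.pack f (GRing.isLinear.Build k U V _ f f_lin).
exact: (lfunE F).
Qed.

(** * Hopf Galois structures *)

Section HopfGaloisForm.
Variables (k : fieldType) (M : splittingFieldType k) (E : {subfield M}).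
Local Notation L := (subvs_of E).
Variables (H : falgType k) (N : finZmodType) (c : N -> {linear H -> M}).
Hypothesis addnn : forall n : N, n + n = 0.
Hypothesis c_free : M_independent c.
Hypothesis c1 : forall n, c n 1 = (n == 0)%:R.
Hypothesis cM : forall g h n, c n (g * h) = \sum_m c m g * c (n - m) h.
Variables (D : {linear H -> tensor H H}) (e : {linear H -> k^o}).
Hypothesis cD : forall h n m, tens_pair (c n) (c m) (D h) = (n == m)%:R * c n h.
Hypothesis ce : forall h, (e h : k) *: (1 : M) = \sum_n c n h.
Variable phi : N -> gal_of {:M}.
Hypothesis phi0 : forall u, phi 0 u = u.
Hypothesis phi_independent : forall y : N -> M,
  (forall a, a \in E -> \sum_n y n * phi n a = 0) -> forall n, y n = 0.
Variable act : {linear H -> 'End(L)}.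
Hypothesis actE : forall h a, vsval (act h a) = \sum_n c n h * phi n (vsval a).
Hypothesis actM : forall g h a, act (g * h) a = act g (act h a).
Hypothesis dimH : \dim {:H} = \dim {:L}.

Let A := group_form addnn c_free c1 cM cD ce.

Let galois_mapE (t : tensor L H) (a : L) :
  vsval (hopf_galois_map (H := A) act t a) =
  \sum_n tens_pair (linfun vsval : 'Hom(L, M)) (c n) t * phi n (vsval a).
Proof.
have actM_lin (s : L) (h : H) : linear (fun b => s * act h b).
  by move=> x y z; rewrite linearP mulrDr -scalerAr.
rewrite /hopf_galois_map; elim/tens_ind: t => [|t t' IHt IHt'|s h].
- by rewrite linear0 lfunE big1 // => n _; rewrite linear0 mul0r.
- rewrite linearD add_lfunE [vsval _]linearD /= IHt IHt' -big_split.
  by apply: eq_bigr => n _; rewrite linearD mulrDl.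
rewrite tens_liftE => [|w|w] => [|x y z|x y z].
- rewrite linfun_linearE // [vsval _]rmorphM /= actE mulr_sumr.
  by apply: eq_bigr => n _; rewrite tens_pairE /= lfunE mulrA.
- apply/lfunP=> b; rewrite add_lfunE scale_lfunE !linfun_linearE //.
  by rewrite mulrDl scalerAl.
apply/lfunP=> b; rewrite add_lfunE scale_lfunE !linfun_linearE //.
by rewrite linearP add_lfunE scale_lfunE mulrDr scalerAr.
Qed.

Let galois_map_inj t :
  hopf_galois_map (H := A) act t = 0 -> t = 0.
Proof.
move=> t0.
(* [tens_pair_inj] wants the independent family on the left, so L (x) H is swapped. *)
have swapK (s : tensor L H) : tens_swap (tens_swap s) = s.
  rewrite /tens_swap; elim/tens_ind: s => [|s s' IHs IHs'|u v].
  - by rewrite !linear0.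
  - by rewrite !linearD /= IHs IHs'.
  by rewrite !tens_liftE // => w; do ?[exact: tens_linear_l | exact: tens_linear_r].
suff s0 : tens_swap t = 0 by rewrite -(swapK t) s0 /tens_swap linear0.
apply: (@tens_pair_inj _ _ _ unit _ _ c (fun _ => linfun vsval : 'Hom(L, M))) => //.
  by move=> v /(_ tt); rewrite /= lfunE => v0; apply: val_inj.
move=> n _; rewrite tens_pair_swap; move: n; apply: phi_independent => a Ea.
have := galois_mapE t (Subvs Ea); rewrite t0 lfunE /= => <-.
by [].
Qed.

Let galois_map_bij :
  bijective (hopf_galois_map (H := A) act).
Proof.
set F := hopf_galois_map _.
have F_lin : linear F by exact: tens_lift_linear.
have FE := linfun_linearE F_lin.
have F_inj : lker (linfun F) == 0%VS.
  apply/lker0P => s t st; apply/eqP; rewrite -subr_eq0; apply/eqP.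
  by apply: galois_map_inj; rewrite -/F -FE linearB /= st subrr.
have F_lim : limg (linfun F) = fullv.
  apply/eqP; rewrite eqEdim subvf limg_dim_eq ?(eqP F_inj) ?capv0 //=.
  rewrite [\dim {:'End(L)}]dimvf [\dim {:tensor L H}]dimvf.
  by rewrite dim_matrix dimH -[dim 'End(L)]/(dim L * dim L)%N -dimvf.
exists (linfun F)^-1%VF => t; rewrite -FE; first exact: lker0_lfunK.
by rewrite limg_lfunVK // F_lim memvf.
Qed.


Lemma group_form_hopf_galois : hopf_galois L.
Proof.
exists A, act; split; last exact: galois_map_bij.
  exact: (form_cocomm c_free cD).
split=> [a|//|h|h a b]; apply: val_inj.
- rewrite /= [LHS]actE (bigD1 0) //= c1 eqxx mul1r phi0.
  by rewrite big1 ?addr0 // => n /negPf n0; rewrite c1 n0 mul0r.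
- rewrite [LHS]actE -[RHS]/((e h : k) *: vsval (1 : L)) rmorph1 ce.
  by apply: eq_bigr => n _; rewrite rmorph1 mulr1.
rewrite [LHS]actE.
have liftE t : vsval (tens_lift (fun g g' => act g a * act g' b) t) =
    \sum_n \sum_m tens_pair (c n) (c m) t * (phi n (vsval a) * phi m (vsval b)).
  elim/tens_ind: t => [|t t' IHt IHt'|g g'].
  - rewrite linear0 big1 // => n _; rewrite big1 // => m _.
    by rewrite linear0 mul0r.
  - rewrite linearD [LHS]linearD /= IHt IHt' -big_split; apply: eq_bigr => n _.
    by rewrite -big_split; apply: eq_bigr => m _; rewrite linearD mulrDl.
  rewrite tens_liftE => [|w|w] => [|x y z|x y z].
  - rewrite [LHS]rmorphM /= !actE big_distrlr; apply: eq_bigr => n _.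
    by apply: eq_bigr => m _; rewrite tens_pairE mulrACA.
  - by rewrite linearP add_lfunE scale_lfunE mulrDl scalerAl.
  by rewrite linearP add_lfunE scale_lfunE mulrDr scalerAr.
rewrite [RHS]liftE; apply: eq_bigr => n _.
rewrite (bigD1 n) //= cD eqxx mul1r big1 ?addr0 ?rmorphM // => m nm.
by rewrite cD eq_sym (negPf nm) !mul0r.
Qed.

End HopfGaloisForm.

(** * Greither-Pareigis descent of M[N] to k *)

Section GreitherPareigis.
Import FalgLfun.
Variables (k : fieldType) (M : splittingFieldType k) (E : {subfield M}).
Hypothesis galM1 : galois 1 {:M}.
Local Notation G := (gal_of {:M}).

Variables (N : finZmodType) (actN : G -> N -> N) (phi : N -> G).
Hypothesis addnn : forall n : N, n + n = 0.
Hypothesis actN1 : forall n, actN 1%g n = n.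
Hypothesis actNM : forall g h n, actN (g * h)%g n = actN h (actN g n).
Hypothesis actND : forall g, {morph actN g : n m / n + m}.
(* phi is the inverse of a crossed homomorphism onto N.                       *)
Hypothesis phiM : forall n m u, phi n (phi m u) = phi (n + actN (phi n) m) u.
Hypothesis phi_E : forall g n e,
  g \in 'Gal({:M} / E)%g -> e \in E -> g (phi n e) = phi (actN g n) e.
Hypothesis phi_inj : forall n m, {in E, phi n =1 phi m} -> n = m.
Hypothesis cardN : #|N| = \dim E.

Local Notation L := (subvs_of E).

Let galE : galois E {:M}.
Proof. by apply: galoisS galM1; rewrite sub1v subvf. Qed.

Let mem_E a : (forall g, g \in 'Gal({:M} / E)%g -> g a = a) -> a \in E.
Proof.
move=> fix_a; have: a \in fixedField 'Gal({:M} / E)%g.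
  by apply/fixedFieldP; rewrite ?memvf.
by rewrite (galois_fixedField galE).
Qed.

(* Evaluate at the relative traces of M / E and use the independence of the   *)
(* automorphisms of M.                                                        *)
Lemma phi_independent (y : N -> M) :
  (forall e, e \in E -> \sum_n y n * phi n e = 0) -> forall n, y n = 0.
Proof.
move=> y0 n0; pose C := 'Gal({:M} / E)%g.
(* [P x n] says that x and phi n agree on E. *)
pose P (x : G) n := (x * (phi n)^-1)%g \in C.
have P0 n : P (phi n0) n = (n == n0).
  apply/idP/eqP => [Pn|->]; last by rewrite /P mulgV group1.
  apply: phi_inj => e Ee; rewrite -[phi n0](mulgKV (phi n)) galM_fun.
  by rewrite (fixed_gal _ Pn) ?subvf.
transitivity (\sum_(n | P (phi n0) n) y n).
  by rewrite (eq_bigl (pred1 n0)) ?big_pred1_eq // => n; rewrite P0.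
apply: (@gal_independent _ _ _ xpredT (fun x => \sum_(n | P x n) y n)) => // u _.
rewrite -[RHS](y0 (\sum_(g in C) g u)); last first.
  apply: mem_E => g Cg; rewrite rmorph_sum [RHS](reindex_acts 'R _ Cg) ?astabsR //=.
  by apply: eq_bigr => x _; rewrite galM_fun.
under [RHS]eq_bigr => n _.
  rewrite rmorph_sum mulr_sumr (reindex_inj (mulIg (phi n)^-1)%g) big_mkcond.
  over.
rewrite exchange_big; apply: eq_bigr => x _; rewrite mulr_suml big_mkcond /=.
apply: eq_bigr => n _; rewrite /P; case: ifP => // _; congr (_ * _).
by rewrite -galM_fun mulgKV.
Qed.

Let actN_inj g : injective (actN g).
Proof. by apply: (can_inj (g := actN g^-1%g)) => n; rewrite -actNM mulgV. Qed.

Let actN0 g : actN g 0 = 0.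
Proof. by apply: (addrI (actN g 0)); rewrite -actND !addr0. Qed.

Let phi0 u : phi 0 u = u.
Proof.
by apply: (fmorph_inj (phi 0)); rewrite /= phiM actN0 addr0.
Qed.

(** The family s stands for the element of M[N] with coefficients s n, acting on M through phi. *)
Definition combination (s : {ffun N -> M}) : 'End(M) :=
  \sum_n (amull (s n) \o phi n)%VF.

Lemma combinationE s u : combination s u = \sum_n s n * phi n u.
Proof.
by rewrite sum_lfunE; apply: eq_bigr => n _; rewrite comp_lfunE lfunE.
Qed.

Lemma combination_linear : linear combination.
Proof.
move=> a s t; apply/lfunP=> u; rewrite add_lfunE scale_lfunE !combinationE scaler_sumr.
by rewrite -big_split; apply: eq_bigr => n _; rewrite !ffunE mulrDl scalerAl.
Qed.

HB.instance Definition _ := GRing.isLinear.Build k {ffun N -> M} 'End(M) _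
  combination combination_linear.

Let ev := linfun combination.

Let ev_lker : lker ev == 0%VS.
Proof.
apply/lker0P => s t; rewrite !lfunE /= => st; apply/ffunP=> n; apply/eqP.
rewrite -subr_eq0; apply/eqP; move: n.
apply: (phi_independent (y := fun n => s n - t n)) => e _.
under eq_bigr do rewrite mulrBl.
by rewrite sumrB -!combinationE st subrr.
Qed.

(** Equivariance becomes the vanishing of one linear map per g, so the equivariant families form a
    [vspace]. *)
Definition equivariant_defect (g : G) :=
  fun s : {ffun N -> M} => [ffun n => g (s n) - s (actN g n)].

Lemma equivariant_defect_linear g : linear (equivariant_defect g).
Proof.
move=> a s t; apply/ffunP=> n; rewrite !ffunE linearP scalerBr opprD.
by rewrite addrACA.
Qed.

HB.instance Definition _ g := GRing.isLinear.Build k {ffun N -> M}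
  {ffun N -> M} _ (equivariant_defect g) (equivariant_defect_linear g).

Definition equivariant_space : {vspace {ffun N -> M}} :=
  (\bigcap_g lker (linfun (equivariant_defect g)))%VS.

Lemma equivariant_spaceP (s : {ffun N -> M}) :
  reflect (equivariant actN s) (s \in equivariant_space).
Proof.
rewrite memvE; apply: (iffP subv_bigcapP) => [Ws g n | Ws g _].
  have := Ws g isT; rewrite -memvE memv_ker lfunE => /eqP/ffunP/(_ n).
  by rewrite !ffunE => /eqP; rewrite subr_eq0 => /eqP.
rewrite -memvE memv_ker lfunE; apply/eqP/ffunP=> n.
by rewrite !ffunE Ws subrr.
Qed.

(** Equivariance turns phi n (s m) into the coefficient of s at m' = actN (phi n) m, and [phiM]
    turns phi n after phi m into phi (n + m'). The two twists cancel, leaving the convolution of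
    M[N]. *)
Lemma combination_mul (s t : {ffun N -> M}) : equivariant actN s ->
  combination s * combination t =
  combination [ffun n => \sum_m s m * t (n - m)].
Proof.
move=> s_eq; apply/lfunP=> u; rewrite lfun_mulE !combinationE.
transitivity (\sum_n \sum_m s m * t n * phi (n + m) u).
  apply: eq_bigr => n _.
  rewrite rmorph_sum mulr_sumr [RHS](reindex_inj (@actN_inj (phi n))).
  apply: eq_bigr => m _.
  by rewrite rmorphM /= s_eq phiM mulrCA mulrA.
rewrite exchange_big; under [RHS]eq_bigr do rewrite ffunE mulr_suml.
rewrite [RHS]exchange_big; apply: eq_bigr => m _ /=.
rewrite [RHS](reindex_inj (addIr m)); apply: eq_bigr => n _.
by rewrite addrK.
Qed.

Lemma combination_delta0 : combination [ffun n => (n == 0)%:R] = 1.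
Proof.
apply/lfunP=> u; rewrite combinationE id_lfunE (bigD1 0) //= ffunE eqxx mul1r.
by rewrite big1 ?addr0 ?phi0 // => n /negPf n0; rewrite ffunE n0 mul0r.
Qed.

Let Hspace : {vspace 'End(M)} := (ev @: equivariant_space)%VS.

Let HspaceP h : reflect (exists2 s : {ffun N -> M}, equivariant actN s & h = combination s)
  (h \in Hspace).
Proof.
apply: (iffP memv_imgP) => [[s /equivariant_spaceP s_eq ->]|[s s_eq ->]].
  by exists s; rewrite // lfunE.
by exists s; rewrite ?lfunE //; apply/equivariant_spaceP.
Qed.

Let Hspace1 : 1 \in Hspace.
Proof.
apply/HspaceP; exists [ffun n => (n == 0)%:R]; last by rewrite combination_delta0.
move=> g n; rewrite !ffunE rmorph_nat; congr (_ %:R).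
by rewrite -{2}(actN0 g) (inj_eq (@actN_inj g)).
Qed.

Fact Hspace_aspace : is_aspace Hspace.
Proof.
rewrite /is_aspace has_algid1 //; apply/prodvP => f f' /HspaceP[s s_eq ->].
move=> /HspaceP[t t_eq ->]; rewrite combination_mul //; apply/HspaceP.
eexists; last by [].
move=> g n; rewrite !ffunE rmorph_sum [RHS](reindex_inj (@actN_inj g)).
apply: eq_bigr => m _; rewrite rmorphM /= s_eq t_eq; congr (_ * t _).
by apply: (addIr (actN g m)); rewrite -actND !subrK.
Qed.

Let H : falgType k := subvs_of (ASpace Hspace_aspace).

Let c_fun n (h : H) : M := (ev^-1%VF (vsval h)) n.

Let c_lin n : linear (c_fun n).
Proof. by move=> a g h; rewrite /c_fun !linearP !ffunE. Qed.

Let c n : {linear H -> M} :=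
  HB.pack (c_fun n) (GRing.isLinear.Build k H M _ (c_fun n) (c_lin n)).

Let c_combination (h : H) s : vsval h = combination s -> forall n, c n h = s n.
Proof.
move=> hs n; rewrite /= /c_fun hs.
have -> : combination s = ev s by rewrite lfunE.
by rewrite lker0_lfunK.
Qed.

Let HP (h : H) :
  exists s : {ffun N -> M}, [/\ equivariant actN s, vsval h = combination s &
               forall n, c n h = s n].
Proof.
have /HspaceP[s s_eq hs] := subvsP h; exists s; split=> //.
exact: c_combination.
Qed.

Let vsval_c (h : H) u : vsval h u = \sum_n c n h * phi n u.
Proof.
have [s [_ -> cs]] := HP h; rewrite combinationE.
by apply: eq_bigr => n _; rewrite cs.
Qed.

Let c_equiv (h : H) : equivariant actN (c^~ h).
Proof. by have [s [s_eq _ cs]] := HP h; move=> g n; rewrite !cs s_eq. Qed.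

Let c_inj (h : H) : (forall n, c n h = 0) -> h = 0.
Proof.
move=> c0; apply: val_inj; apply/lfunP=> u; rewrite [LHS]vsval_c.
by rewrite big1 ?lfunE // => n _; rewrite c0 mul0r.
Qed.

Let c_im s : equivariant actN s -> exists h : H, forall n, c n h = s n.
Proof.
move=> s_eq.
have Hs : combination (finfun s) \in Hspace.
  by apply/HspaceP; exists (finfun s) => // g n; rewrite !ffunE.
exists (Subvs Hs) => n; rewrite (@c_combination _ (finfun s)) ?ffunE //.
Qed.

Let c_free : M_independent c.
Proof. exact: (equivariant_independent galM1 actN1 actNM c_equiv c_inj). Qed.

Let dimH : \dim {:H} = \dim E.
Proof.
by rewrite (equivariant_dim galM1 actN1 actNM c_equiv c_inj c_im) cardN.
Qed.

Let one_H : vsval (1 : H) = 1.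
Proof.
by apply/eqP; rewrite -[vsval 1]/(algid (ASpace Hspace_aspace)) algid_eq1 Hspace1.
Qed.

Let c1 n : c n 1 = (n == 0)%:R.
Proof.
by rewrite (@c_combination _ [ffun n => (n == 0)%:R]) ?ffunE // one_H combination_delta0.
Qed.

Let cM (g h : H) n : c n (g * h) = \sum_m c m g * c (n - m) h.
Proof.
have [s [s_eq gs cs]] := HP g; have [t [t_eq ht ct]] := HP h.
rewrite (@c_combination _ [ffun n => \sum_m s m * t (n - m)]).
  by rewrite ffunE; apply: eq_bigr => m _; rewrite cs ct.
by rewrite -combination_mul // -gs -ht.
Qed.

(** The dual tensor w has coordinates delta_nm. Its left legs are multiplied coefficientwise by h,
    which stays in H because products of equivariant families are equivariant. *)
Let diag (h : H) : exists t : tensor H H,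
  forall n m, tens_pair (c n) (c m) t = (n == m)%:R * c n h.
Proof.
have [w wE] := dual_basis galM1 actN1 actNM c_equiv c_inj c_im.
have cE g (g' : G) n : g' (c n g) = c (actN g' n) g by exact: c_equiv.
have mul_ex (g : H) : exists f : H, forall n, c n f = c n h * c n g.
  by apply: (c_im (s := fun n => c n h * c n g)) => g' n; rewrite rmorphM /= !cE.
have [f fE] : exists f : 'I_(\dim {:H}) -> H, forall q n,
    c n (f q) = c n h * c n (vbasis {:H})`_q.
  have /fin_all_exists[f fE] (q : 'I_(\dim {:H})) : exists f : H, forall n,
      c n f = c n h * c n (vbasis {:H})`_q by exact: mul_ex.
  by exists f.
exists (\sum_p \sum_q w p q *: tens (f p) (vbasis {:H})`_q) => n m.
rewrite -wE mulrC linear_sum.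
rewrite -[tens_pair _ _ w]/(tens_lift (fun u v => c n u * c m v : M) w).
rewrite /tens_lift mulr_sumr.
apply: eq_bigr => p _; rewrite linear_sum mulr_sumr; apply: eq_bigr => q _.
by rewrite linearZ tens_pairE fE -mulrA /= scalerAr.
Qed.

(** The augmentation is G-invariant, hence a scalar (see [ce]); [coord] reads this scalar
    linearly. *)
Let counit_fun (h : H) : k^o := coord [tuple (1 : M)] ord0 (\sum_n c n h).

Let counit_lin : linear counit_fun.
Proof.
move=> a g h; rewrite /counit_fun.
under eq_bigr do rewrite linearP.
by rewrite big_split -scaler_sumr linearP.
Qed.

Let e : {linear H -> k^o} := HB.pack counit_fun
  (GRing.isLinear.Build k H k^o _ counit_fun counit_lin).

Let ce (h : H) : (e h : k) *: (1 : M) = \sum_n c n h.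
Proof.
have /vlineP[a aE] : (\sum_n c n h : M) \in (1%VS : {vspace M}).
  apply: (gal_fixed_in1 galM1) => g.
  rewrite rmorph_sum [RHS](reindex_inj (@actN_inj g)).
  by apply: eq_bigr => n _; apply: c_equiv.
rewrite /= /counit_fun aE linearZ /=; congr (_ *: _).
have /= -> := @coord_free k M 1 [tuple (1 : M)] ord0 ord0; first by rewrite mulr1.
by rewrite seq1_free oner_eq0.
Qed.

Let act_fun (h : H) : 'End(L) :=
  (linfun (vsproj E) \o vsval h \o linfun vsval)%VF.

Let act_lin : linear act_fun.
Proof.
move=> a g h; apply/lfunP=> u; rewrite add_lfunE scale_lfunE !comp_lfunE.
by rewrite linearP add_lfunE scale_lfunE linearP.
Qed.

Let act : {linear H -> 'End(L)} := HB.pack act_fun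
  (GRing.isLinear.Build k H 'End(L) _ act_fun act_lin).

(** The projection to E changes nothing: Gal(M/E) permutes the coefficients and, by [phi_E], the
    values phi n a in the same way, so their sum lies in E. *)
Let actE (h : H) (a : L) : vsval (act h a) = \sum_n c n h * phi n (vsval a).
Proof.
rewrite /= /act_fun !comp_lfunE !lfunE /= -vsval_c vsprojK // vsval_c.
apply: mem_E => g Cg; rewrite rmorph_sum [RHS](reindex_inj (@actN_inj g)).
apply: eq_bigr => n _; rewrite rmorphM /= phi_E ?subvsP //.
by congr (_ * _); apply: c_equiv.
Qed.

(* The product of 'End(M) is g * h = h \o g, so actions need commutativity.   *)
Let mulHC (g h : H) : g * h = h * g.
Proof.
apply/eqP; rewrite -subr_eq0; apply/eqP/c_inj => n.
rewrite linearB !cM (reindex_inj (inv_inj (subKr n))) /=.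
rewrite -sumrB big1 // => m _.
by rewrite subKr mulrC subrr.
Qed.

Theorem greither_pareigis_descent : hopf_galois L.
Proof.
have [D cD] := diag_comul diag.
apply: (group_form_hopf_galois addnn c_free c1 cM cD ce phi0 phi_independent actE).
  have act_val (h : H) (a : L) : vsval (act h a) = vsval h (vsval a).
    by rewrite actE vsval_c.
  move=> g h a; rewrite mulHC; apply: val_inj.
  by rewrite [LHS]act_val [RHS]act_val act_val -lfun_mulE.
by rewrite dimH dimvf.
Qed.

End GreitherPareigis.

(** * Resultants *)

Section ResultantRoots.
Variable F : fieldType.

(** Multiplying the Sylvester matrix by columns of powers of r i evaluates its rows X^j p and X^j q
    at r i, and the former vanish. The sign appears because its coefficients are listed by
    increasing degree. *)
Lemma resultant_prod_roots (p q : {poly F}) n (r : 'I_n -> F) :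
    (size p).-1 = n -> p = lead_coef p *: \prod_i ('X - (r i)%:P) ->
    injective r -> (forall i, r i != 0) ->
  resultant p q = (-1) ^+ (n * (size q).-1) * lead_coef p ^+ (size q).-1
                  * \prod_i q.[r i].
Proof.
move=> size_p; case: n / size_p r => r pE r_inj r_neq0.
set m := (size p).-1 in r pE r_inj r_neq0 *; set l := (size q).-1.
(* S *m W and W are block triangular, with determinants p`_0 ^ l det Q and    *)
(* det V (prod_i r i) ^ l; this is where the roots must be nonzero.           *)
pose V : 'M_m := Vandermonde m (\row_i r i).
pose W : 'M_(l + m) := block_mx 1%:M (\matrix_(j, i) r i ^+ j)
                                0 (\matrix_(j, i) r i ^+ (l + j)).
pose S := Sylvester_mx p q : 'M_(l + m).
pose A : 'M_l := \matrix_(j, i) ('X^j * p)`_i.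
pose Q : 'M_m := \matrix_(j, i) (r i ^+ j * q.[r i]).
have SE i t : S i t = match split i with
    inl k => ('X^k * p)`_t | inr k => ('X^k * q)`_t end.
  rewrite Sylvester_mxE; case: (split i) => j; rewrite coefXnM ltnNge;
  by case: (j <= t)%N; rewrite /= ?mulr1n ?mulr0n.
have W_r (s : 'rV_(l + m)) i : (s *m W) 0 (rshift l i) = \sum_t s 0 t * r i ^+ t.
  rewrite mxE; apply: eq_bigr => t _; congr (_ * _).
  by case: (split_ordP t) => k ->; rewrite (block_mxEur, block_mxEdr) mxE.
have W_l (s : 'rV_(l + m)) i : (s *m W) 0 (lshift m i) = s 0 (lshift m i).
  rewrite mxE big_split_ord /= (bigD1 i) //= block_mxEul mxE eqxx mulr1.
  rewrite !big1 ?addr0 // => [k|k ki]; first by rewrite block_mxEdl mxE mulr0.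
  by rewrite block_mxEul mxE (negPf ki) mulr0.
have size_Xp (s : {poly F}) (j d : nat) : (j < d)%N ->
    (size ('X^j * s)%R <= d + (size s).-1)%N.
  move=> jd; apply: leq_trans (size_polyMleq _ _) _.
  rewrite size_polyXn addSn /=; case: (size s) => [|z]; first by rewrite !addn0 ltnW.
  by rewrite addnS /= ltn_add2r.
have p_r i : p.[r i] = 0.
  by rewrite pE hornerZ horner_prod (bigD1 i) //= hornerXsubC subrr mul0r mulr0.
have SW_p (j : 'I_l) i : (row (lshift m j) S *m W) 0 (rshift l i) = 0.
  rewrite W_r; transitivity (('X^j * p).[r i]); last by rewrite hornerM p_r mulr0.
  rewrite (@horner_coef_wide _ (l + m)) ?size_Xp //.
  apply: eq_bigr => t _; rewrite mxE SE.
  by rewrite -[lshift m j]/(unsplit (inl j)) unsplitK.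
have SW_q (j : 'I_m) i :
    (row (rshift l j) S *m W) 0 (rshift l i) = r i ^+ j * q.[r i].
  rewrite W_r; transitivity (('X^j * q).[r i]); last by rewrite !hornerE.
  rewrite (@horner_coef_wide _ (l + m)) 1?addnC ?size_Xp //.
  apply: eq_bigr => t _; rewrite mxE SE.
  by rewrite -[rshift l j]/(unsplit (inr j)) unsplitK.
have SW_A (j i : 'I_l) : (row (lshift m j) S *m W) 0 (lshift m i) = A j i.
  rewrite W_l [LHS]mxE SE mxE.
  by rewrite -[lshift m j]/(unsplit (inl j)) unsplitK.
have SWE : S *m W = block_mx A 0 (dlsubmx (S *m W)) Q.
  apply/matrixP=> i j; rewrite -[i]splitK -[j]splitK.
  case: (split i) => i'; case: (split j) => j' /=.
  - by rewrite block_mxEul -SW_A -row_mul [RHS]mxE.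
  - by rewrite block_mxEur [RHS]mxE -(SW_p i' j') -row_mul [RHS]mxE.
  - by rewrite block_mxEdl [RHS]mxE [RHS]mxE.
  by rewrite block_mxEdr [RHS]mxE -SW_q -row_mul [RHS]mxE.
have detA : \det A = p`_0 ^+ l.
  rewrite -det_tr det_trig.
    rewrite -[l in RHS]card_ord -prodr_const; apply: eq_bigr => i _.
    by rewrite !mxE coefXnM ltnn subnn.
  by apply/is_trig_mxP => i j ij; rewrite !mxE coefXnM ij.
have p0 : p`_0 = (-1) ^+ m * (lead_coef p * \prod_i r i).
  rewrite -horner_coef0 {1}pE hornerZ horner_prod mulrCA; congr (_ * _).
  transitivity (\prod_i - r i); last by rewrite prodrN card_ord.
  by apply: eq_bigr => i _; rewrite hornerXsubC sub0r.
have detQ : \det Q = \det V * \prod_i q.[r i].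
  transitivity (\det (V *m diag_mx (\row_i q.[r i]))).
    by congr (\det _); apply/matrixP=> i j; rewrite mul_mx_diag !mxE.
  by rewrite det_mulmx det_diag; congr (_ * _); apply: eq_bigr => i _; rewrite mxE.
have detW : \det W = \det V * (\prod_i r i) ^+ l.
  rewrite det_ublock det1 mul1r.
  transitivity (\det (V *m diag_mx (\row_i r i ^+ l))).
    congr (\det _); apply/matrixP=> i j.
    by rewrite mul_mx_diag !mxE exprD mulrC.
  rewrite det_mulmx det_diag; congr (_ * _); rewrite -prodrXl.
  by apply: eq_bigr => i _; rewrite mxE.
have V_neq0 : \det V != 0.
  rewrite det_Vandermonde; apply/prodf_neq0 => i _; apply/prodf_neq0 => j ij.
  by rewrite !mxE subr_eq0 (inj_eq r_inj) -val_eqE /= gtn_eqF.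
have r_neq0' : \prod_i r i != 0 by apply/prodf_neq0.
apply: (@mulIf _ (\det W)); first by rewrite detW mulf_neq0 ?expf_neq0.
rewrite -[resultant p q]/(\det S) -det_mulmx SWE det_lblock detA detQ p0 detW.
rewrite exprMn exprMn -exprM; ring.
Qed.

End ResultantRoots.

(** * Regular subgroups of translation groups *)

Section AlmostClassicalNormal.
Local Open Scope group_scope.
Variables (gT : finGroupType) (G H : {group gT}).

Lemma translationE g X : g \in G -> X \in rcosets H G ->
  translation G H g X = X :* g.
Proof.
move=> Gg HX; rewrite /translation restr_permE //; first by rewrite actpermE /= rcosetE.
apply/astabsP=> Y /=; rewrite /aperm actpermE.
exact: (acts_act (actsRs_rcosets H G) Gg).
Qed.

Lemma translation_fixed_out g X : X \notin rcosets H G ->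
  translation G H g X = X.
Proof. by move=> HX; rewrite /translation (out_perm (restr_perm_on _ _)). Qed.

Lemma translationM : {in G &, {morph translation G H : g h / g * h}}.
Proof.
move=> g h Gg Gh; apply/permP=> X; rewrite permM.
have [HX|HX] := boolP (X \in rcosets H G); last first.
  by rewrite !translation_fixed_out.
have HXg : X :* g \in rcosets H G.
  by have := acts_act (actsRs_rcosets H G) Gg X; rewrite /= rcosetE HX.
by rewrite !translationE ?groupM ?rcosetM.
Qed.

Canonical translation_morphism := Morphism translationM.

Lemma almost_classical_pair_normal :
    G \subset <<[set s in G | s ^+ 2 == 1]>> -> odd #|H| -> 2%N.-nat #|G : H| ->
    H \subset G ->
  almost_classical_pair G H -> H <| G.
Proof.
move=> G_gen H_odd GH_2 sHG [N [N_sym N_reg N_norm N_sub]].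
have HH : gval H \in rcosets H G by apply/rcosetsP; exists 1; rewrite ?mulg1.
pose T := [group of translation G H @* G].
have TE : translation G H @: G = T by rewrite /= morphimEdom.
rewrite TE in N_norm N_sub.
have cardN : #|N| = #|G : H|.
  have orbE : rcosets H G = [set p (gval H) | p : {perm {set gT}} in N].
    apply/setP=> X; apply/idP/imsetP => [HX|[p Np ->]].
      by have [p [[Np pX] _]] := N_reg _ _ HH HX; exists p.
    by have := subsetP N_sym p Np; rewrite inE => /perm_closed ->.
  rewrite /indexg orbE card_in_imset // => p q Np Nq pq.
  have HX : p (gval H) \in rcosets H G by rewrite orbE imset_f.
  have [p' [_ uniq_p]] := N_reg _ _ HH HX.
  by rewrite -(uniq_p p) // -(uniq_p q).
have N_hall : 2%N.-Hall(T) N.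
  rewrite /pHall N_sub /pgroup cardN GH_2 /=.
  have : (#|T : N| %| #|H|)%N.
    rewrite -(@dvdn_pmul2l #|N|) ?cardG_gt0 // Lagrange // cardN mulnC Lagrange //.
    exact: dvdn_morphim.
  by move/dvdn_odd/(_ H_odd); rewrite odd_2'nat.
have N_normal : N <| T by rewrite /normal N_sub.
have G_N g : g \in G -> translation G H g \in N.
  suff /subsetP/(_ g)/[apply]/morphpreP[] : G \subset translation G H @*^-1 N by [].
  apply: subset_trans G_gen _; rewrite gen_subG; apply/subsetP=> s.
  rewrite inE => /andP[Gs /eqP s2]; apply/morphpreP; split=> //.
  rewrite (mem_normal_Hall N_hall N_normal) ?mem_morphim //.
  rewrite /p_elt (@pnat_dvd _ 2) ?pnat_id // order_dvdn -morphX // s2.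
  by rewrite morph1.
rewrite /normal sHG; apply/subsetP=> g Gg; rewrite inE; apply/subsetP=> _ /imsetP[h Hh ->].
have Gh := subsetP sHG h Hh.
(* The translation by h lies in N and fixes the coset H, as the identity does. *)
have trh1 : translation G H h = 1.
  have [p [_ uniq_p]] := N_reg _ _ HH HH.
  rewrite -(uniq_p (translation G H h)); last first.
    by split; [exact: G_N | rewrite translationE // rcoset_id].
  by apply: uniq_p; split; [exact: group1 | rewrite perm1].
(* Triviality of h on the coset of g^-1 says that the conjugate h ^ g lies in H. *)
have HX : H :* g^-1 \in rcosets H G by apply/rcosetsP; exists g^-1; rewrite ?groupV.
have := translationE Gh HX; rewrite trh1 perm1 -rcosetM => /esym/rcoset_eqP.
by rewrite mem_rcoset invgK conjgE mulgA.
Qed.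

End AlmostClassicalNormal.

(** Joins the finite and additive structures on pairs, so that N = (bool * bool) * bool, with bool
    as Z/2, is a [finZmodType]. *)
HB.instance Definition _ (U V : finZmodType) := Finite.on (U * V)%type.

(** * Quartics with Galois group S_4 *)

Section KleinPlane.
Local Notation T := (bool * bool)%type.

Let sum_T (F : T -> T) :
  \sum_i F i = F (true, true) + F (true, false) + (F (false, true) + F (false, false)).
Proof.
transitivity (\sum_i \sum_j F (i, j)); last by rewrite !big_bool /=.
by rewrite pair_bigA; apply: eq_bigr => -[i j].
Qed.

(* The four values of a permutation sum to 0, and in the plane over F_2 that *)
(* is all it takes to be affine.                                             *)
Lemma perm_klein_affine (p : {perm T}) a b :
  p (a + b) - p 0 = (p a - p 0) + (p b - p 0).
Proof.
have: \sum_i p i = 0.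
  transitivity (\sum_(i : T) i); last by rewrite sum_T.
  by rewrite [RHS](reindex_inj (@perm_inj _ p)).
rewrite sum_T -addrA => /eqP; rewrite addr_eq0 => /eqP p11.
have -> : (0 : T) = (false, false) by [].
case: a b => [[] []] [[] []].
all: rewrite -?[p (_ + _)]/(p (true, true)) -?[p (_ + _)]/(p (true, false))
  -?[p (_ + _)]/(p (false, true)) -?[p (_ + _)]/(p (false, false)).
all: rewrite ?p11; move: (p (true, false)) (p (false, true)) (p (false, false)).
all: by move=> [[] []] [[] []] [[] []].
Qed.

Lemma klein_addnn (a : T) : a + a = 0.
Proof. by case: a => [[] []]. Qed.

End KleinPlane.

Section Quartic.
Variables (k : numFieldType) (M : splittingFieldType k).
Hypothesis galM1 : galois 1 {:M}.
Local Notation G := (gal_of {:M}).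
Local Notation T := (bool * bool)%type.
Variable r : T -> M.
Hypothesis r_inj : injective r.
Hypothesis r_gal : forall (g : G) i, exists j, g (r i) = r j.
Hypothesis r_gen : forall K : {subfield M}, (forall i, r i \in K) -> K = {:M}%AS.
Hypothesis cardG : #|[set: G]| = 24%N.

(** The elements on which g and h agree form a subfield. *)
Lemma gal_eq_on (rs : seq M) (g h : G) :
  {in rs, g =1 h} -> {in <<1 & rs>>%VS, g =1 h}.
Proof.
move=> gh a Ka.
suff /subvP/(_ a Ka) : (<<1 & rs>> <= ker_sub_ahom_aspace g h)%VS.
  by rewrite memv_ker add_lfunE opp_lfunE subr_eq0 => /eqP.
apply/Fadjoin_seqP; split; first exact: sub1v.
by move=> y /gh ghy; rewrite memv_ker add_lfunE opp_lfunE subr_eq0 ghy.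
Qed.

Let gal_ext (g h : G) : (forall i, g (r i) = h (r i)) -> g = h.
Proof.
move=> gh; apply/eqP/gal_eqP => a _.
have /r_gen KE : forall i, r i \in ker_sub_ahom_aspace g h.
  by move=> i; rewrite memv_ker add_lfunE opp_lfunE subr_eq0 gh.
have : a \in ker_sub_ahom_aspace g h by rewrite KE memvf.
by rewrite memv_ker add_lfunE opp_lfunE subr_eq0 => /eqP.
Qed.

Let root_perm : exists pi : G -> {perm T}, forall (g : G) i, g (r i) = r (pi g i).
Proof.
have /fin_all_exists[pi piE] (g : G) :
    exists p : {perm T}, forall i, g (r i) = r (p i).
  have /fin_all_exists[f fE] (i : T) : exists j : T, g (r i) = r j by exact: r_gal.
  have f_inj : injective f.
    by move=> i j fij; apply/r_inj/(fmorph_inj g); rewrite /= !fE fij.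
  by exists (perm f_inj) => i; rewrite permE.
by exists pi.
Qed.

(** G embeds in the permutations of the four roots, and both have 24 elements. *)
Let root_perm_onto : exists rho : {perm T} -> G, forall p i, rho p (r i) = r (p i).
Proof.
have [pi piE] := root_perm.
have pi_inj : injective pi.
  by move=> g h gh; apply: gal_ext => i; rewrite !piE gh.
have card_T : (#|{: {perm T}}| <= #|{: G}|)%N.
  have -> : #|{: {perm T}}| = #|perm_on [set: T]|.
    by apply: eq_card => p; rewrite inE; apply/esym/subsetP => i _; rewrite inE.
  by rewrite card_perm cardsT card_prod card_bool -cardsT cardG.
have [rho _ rhoK] := inj_card_bij pi_inj card_T.
by exists rho => p i; rewrite piE rhoK.
Qed.

Variable b : k.
Hypothesis b_neq0 : b != 0.
Let r0 := r (false, false).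
Let r1 := r (true, false).
Let r2 := r (false, true).
Let r3 := r (true, true).
Variable w : M.
Hypothesis wE : w =
  b *: ((r0 - r1) * (r0 - r2) * (r0 - r3) * (r1 - r2) * (r1 - r3) * (r2 - r3)).
Hypothesis w_sqr : exists c : k, w ^+ 2 = c *: 1.
Variable E : {subfield M}.
Hypothesis E_def : E = <<1 & [:: r0; w]>>%AS.
Hypothesis deg_r0 : \dim <<1; r0>> = 4%N.

Let w_neq0 : w != 0.
Proof.
have nz i j : i != j -> r i - r j != 0 by rewrite subr_eq0 (inj_eq r_inj).
by rewrite wE scaler_eq0 negb_or b_neq0 !mulf_neq0 ?nz.
Qed.

Let N_w : - w != w.
Proof.
rewrite eq_sym -subr_eq0 opprK -mulr2n -scaler_nat scaler_eq0 negb_or w_neq0.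
by rewrite pnatr_eq0.
Qed.

Let E_r0 : r0 \in E.
Proof. by rewrite E_def; apply: seqv_sub_adjoin; rewrite inE eqxx. Qed.

Let E_w : w \in E.
Proof. by rewrite E_def; apply: seqv_sub_adjoin; rewrite !inE eqxx orbT. Qed.

Let swap (c : bool) (i : T) : T := if c then (i.2, i.1) else i.

Let swapK c : involutive (swap c).
Proof. by case: c => -[]. Qed.

(** These eight affine maps of the plane form a dihedral group of order 8. *)
Let sig_fun (n : T * bool) i := swap n.2 i + n.1.

Let sig_inj n : injective (sig_fun n).
Proof. by move=> i j /addIr; apply: (inv_inj (swapK _)). Qed.

Section WithActions.
Variables (pi : G -> {perm T}) (rho : {perm T} -> G).
Hypothesis piE : forall (g : G) i, g (r i) = r (pi g i).
Hypothesis rhoE : forall p i, rho p (r i) = r (p i).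

Let phi n := rho (perm (@sig_inj n)).

Let phiE n i : phi n (r i) = r (swap n.2 i + n.1).
Proof. by rewrite rhoE permE. Qed.

Let pi_phi n i : pi (phi n) i = swap n.2 i + n.1.
Proof. by apply: r_inj; rewrite -piE phiE. Qed.

(** Translations are even permutations of the roots, and the swap is the transposition of r1 and
    r2. *)
Let phi_w n : phi n w = if n.2 then - w else w.
Proof.
have := (phiE n (false, false), phiE n (true, false),
         (phiE n (false, true), phiE n (true, true))).
rewrite -/r0 -/r1 -/r2 -/r3 => -[[e0 e1] [e2 e3]].
rewrite wE linearZ /= -scalerN; case: n e0 e1 e2 e3 => [[a a'] c] /= e0 e1 e2 e3.
rewrite -[if c then _ else _](fun_if (fun x => b *: x) c); congr (_ *: _).
rewrite !rmorphM !rmorphB /= e0 e1 e2 e3.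
by case: a a' c {e0 e1 e2 e3} => [] [] [] /=;
   rewrite -/r0 -/r1 -/r2 -/r3; ring.
Qed.

Let phi_r0 n : phi n r0 = r n.1.
Proof.
by rewrite phiE; congr r; case: n => -[a a'] [].
Qed.

Lemma quartic_dim : \dim E = 8%N.
Proof.
have -> : E = <<<<1; r0>>; w>>%AS :> {vspace M}.
  by rewrite E_def /= !adjoin_cons adjoin_nil subfield_closed.
rewrite dim_Fadjoin deg_r0; set d := adjoin_degree _ _.
(* The degree of w over k(r0) is 2: w^2 is in k, while phi (0, true) fixes r0 and negates w. *)
have d_gt0 : (0 < d)%N by [].
have d_neq1 : d != 1%N.
  rewrite adjoin_deg_eq1; apply: contra N_w => r0_w.
  have r0_eq : {in [:: r0], phi (0, true) =1 (1%g : G)}.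
    by move=> y; rewrite inE => /eqP ->; rewrite gal_id phi_r0.
  have := gal_eq_on r0_eq; rewrite adjoin_seq1 => /(_ w r0_w).
  by rewrite gal_id phi_w /= => ->.
have : (d <= 2)%N.
  have [c cE] := w_sqr.
  pose P := 'X^2 - (c%:A)%:P : {poly M}.
  have P_w : root P w by rewrite /root !hornerE cE subrr.
  have P_over : P \is a polyOver <<1; r0>>%VS.
    by rewrite rpredB ?rpredX ?polyOverX // polyOverC rpredZ ?rpred1.
  have := dvdp_leq _ (minPoly_dvdp P_over P_w).
  rewrite size_XnsubC // size_minPoly ltnS; apply.
  by rewrite -size_poly_gt0 size_XnsubC.
by case: (d) d_gt0 d_neq1 => [|[|[|]]].
Qed.

(** By [perm_klein_affine] pi g is affine; its linear part a |-> pi g a - pi g 0 is the conjugation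
    action on translations. *)
Let act g (n : T * bool) := (pi g n.1 - pi g 0, n.2).

Let piM (g h : G) i : pi (g * h)%g i = pi h (pi g i).
Proof. by apply: r_inj; rewrite -!piE galM_fun. Qed.

Let perm_affineB (p : {perm T}) i j : p (i - j) - p 0 = p i - p j.
Proof.
have := perm_klein_affine p (i - j) j; rewrite subrK => /(congr1 (fun z => z - (p j - p 0))).
by rewrite addrK => <-; rewrite opprB addrA subrK.
Qed.

Lemma quartic_hopf_galois : hopf_galois (subvs_of E).
Proof.
apply: (@greither_pareigis_descent _ _ _ galM1 _ act phi).
- by move=> [a c]; congr pair; [exact: klein_addnn | case: c].
- move=> [a c]; congr pair; rewrite /=.
  have pi1 i : pi 1%g i = i by apply: r_inj; rewrite -piE gal_id.
  by rewrite !pi1 subr0.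
- by move=> g h [a c]; congr pair; rewrite /= !piM perm_affineB.
- by move=> g [a c] [a' c']; congr pair; exact: perm_klein_affine.
- move=> n m u; rewrite -galM_fun; congr (gal_repr _ u); apply: gal_ext => i.
  rewrite galM_fun !phiE; congr r; rewrite /= !pi_phi.
  by case: n m i => -[[] []] [] [[[] []] []] [[] []].
(* An automorphism over E fixes the origin r0, so it acts linearly on the plane; it suffices to
   compare both sides on r0 and w. *)
- move=> g n e Cg Ee.
  have g_r0 : g r0 = r0 by rewrite (fixed_gal _ Cg) ?subvf.
  have g_w : g w = w by rewrite (fixed_gal _ Cg) ?subvf.
  have pi_g0 : pi g 0 = 0 by apply: r_inj; rewrite -piE.
  rewrite -galM_fun; move: e Ee; rewrite E_def; apply: gal_eq_on => y.
  rewrite !inE => /orP[] /eqP->; rewrite galM_fun ?phi_r0 ?phi_w.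
    by rewrite /= piE pi_g0 subr0.
  by rewrite /=; case: n.2; rewrite ?rmorphN /= g_w.
- move=> [a c] [a' c'] nm; have /= := nm _ E_r0; rewrite !phi_r0 /= => /r_inj ->.
  have /= := nm _ E_w; rewrite !phi_w /=; case: c c' {nm} => [] [] // /eqP.
    by rewrite (negPf N_w).
  by rewrite eq_sym (negPf N_w).
by rewrite quartic_dim !card_prod card_bool.
Qed.

Lemma quartic_not_almost_classical : ~ almost_classically_galois E.
Proof.
have gal1T : 'Gal({:M} / 1)%g = [set: G].
  apply/setP=> g; rewrite inE (gal_kAut _ (sub1v _)) kAut1E.
  by rewrite subvf.
have galE : galois E {:M} by apply: galoisS galM1; rewrite sub1v subvf.
move=> [K [galK EK _] acp].
(* A normal K containing r0 contains all its conjugates phi (i, false) r0 = r i. *)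
have KM : K = {:M}%AS.
  apply: r_gen => i; have /and3P[_ _ normK] := galK.
  have <- : phi (i, false) r0 = r i by rewrite phi_r0.
  have Kr0 : r0 \in K := subvP EK _ E_r0.
  have := normalField_root_minPoly (sub1v _) normK Kr0.
  case/(_ (phi (i, false) r0)) => [|g _ <-]; last exact: memv_gal.
  by apply: (root_minPoly_gal (sub1v {:M})); rewrite ?gal1T ?inE ?memvf.
move: acp; rewrite {K galK EK}KM => acp.
have rhoM p q : rho (p * q)%g = (rho p * rho q)%g.
  by apply: gal_ext => i; rewrite galM_fun !rhoE permM.
have rho1 : rho 1%g = 1%g by apply: gal_ext => i; rewrite rhoE perm1 gal_id.
have cardM : \dim {:M} = 24%N.
  by rewrite -cardG -gal1T -(galois_dim galM1) dimv1 divn1.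
have cardC : #|'Gal({:M} / E)%g| = 3%N by rewrite -(galois_dim galE) quartic_dim cardM.
have sCG : 'Gal({:M} / E)%g \subset 'Gal({:M} / 1)%g by rewrite galS ?sub1v.
have C_normal : ('Gal({:M} / E) <| 'Gal({:M} / 1))%g.
  apply: (almost_classical_pair_normal _ _ _ sCG acp).
  3: by rewrite -divgS //= cardC gal1T cardG.
  2: by rewrite cardC.
  (* Transpositions are involutions and generate the symmetric group. *)
  apply/subsetP=> g _; have -> : g = rho (pi g) by apply: gal_ext => i; rewrite rhoE piE.
  have [ts -> _] := prod_tpermP (pi g).
  elim: ts => [|t ts IHts]; first by rewrite big_nil rho1 group1.
  rewrite big_cons rhoM groupM //; apply: mem_gen; rewrite in_set /= gal1T in_setT /=.
  by rewrite expgS expg1 -rhoM tperm2 rho1.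
(* A normal subgroup fixing r0 fixes every conjugate of r0, hence is trivial; but this one has order
   3. *)
suff C1 : 'Gal({:M} / E)%g \subset [1 G]%g.
  by have := subset_leq_card C1; rewrite cardC cards1.
apply/subsetP=> g Cg; rewrite inE; apply/eqP/gal_ext => i; rewrite gal_id.
set h := phi (i, false).
have Cgh : (h * g * h^-1)%g \in 'Gal({:M} / E)%g.
  rewrite -[h in (h * g)%g]invgK -mulgA -conjgE memJ_norm //.
  by apply: (subsetP (normal_norm C_normal)); rewrite gal1T inE.
have hE : h r0 = r i by rewrite phi_r0.
rewrite -hE -galM_fun -[(h * g)%g](mulgKV h) galM_fun.
by rewrite (fixed_gal _ Cgh) ?subvf.
Qed.

End WithActions.

Theorem quartic_compositum :
  [/\ hopf_galois (subvs_of E), \dim E = 8%N & ~ almost_classically_galois E].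
Proof.
have [pi piE] := root_perm; have [rho rhoE] := root_perm_onto.
split; [exact: quartic_hopf_galois piE rhoE | exact: quartic_dim rhoE |].
exact: quartic_not_almost_classical piE rhoE.
Qed.

End Quartic.

(** * Irreducible quartics and their discriminant *)

Lemma irreducible_separable (k : numFieldType) (f : {poly k}) :
  irreducible_poly f -> separable_poly f.
Proof.
move=> [f_gt1 f_irr]; rewrite unlock coprimep_def.
have f_neq0 : f != 0 by rewrite -size_poly_gt0 ltnW.
apply/negPn/negP => /f_irr/(_ (dvdp_gcdl _ _)) gE.
have : f %| f^`() by rewrite -(eqp_dvdl _ gE) dvdp_gcdr.
have f'_neq0 : f^`() != 0.
  apply: contraTneq f_gt1 => /polyP/(_ (size f).-2); rewrite coef_deriv coef0.
  case: (size f) (lead_coefE f) => [|[|n]] //= fE.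
  by move/eqP; rewrite mulrn_eq0 -fE lead_coef_eq0 (negPf f_neq0).
by move/(dvdp_leq f'_neq0); rewrite leqNgt lt_size_deriv.
Qed.

Lemma irreducible_adjoin_degree (k : fieldType) (M : fieldExtType k)
    (f : {poly k}) (y : M) :
    irreducible_poly f -> root (map_poly (GRing.in_alg M) f) y ->
  adjoin_degree 1 y = (size f).-1.
Proof.
move=> [f_gt1 f_irr] fy.
have /polyOver1P[q qE] := minPolyOver 1%AS y.
have : q %= f.
  apply: f_irr.
    by rewrite -(size_map_poly (GRing.in_alg M)) -qE size_minPoly.
  rewrite -(dvdp_map (GRing.in_alg M)) -qE minPoly_dvdp //.
  by apply/polyOver1P; exists f.
by move/eqp_size <-; rewrite -(size_map_poly (GRing.in_alg M)) -qE size_minPoly.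
Qed.

(** The derivative at a root is a times the product of its differences with the others, so each of
    the six pairs occurs with both signs and the signs cancel. The power of a is a^3 a^4 = a
    (a^3)^2; 4 != 0 keeps the derivative of degree 3. *)
Lemma resultant_deriv_quartic (F : fieldType) (a r0 r1 r2 r3 : F) :
    a != 0 -> 4%:R != 0 :> F -> uniq [:: r0; r1; r2; r3] ->
    0 \notin [:: r0; r1; r2; r3] ->
  let p := a *: \prod_(y <- [:: r0; r1; r2; r3]) ('X - y%:P) in
  resultant p p^`() = a *
    (a ^+ 3 * ((r0 - r1) * (r0 - r2) * (r0 - r3) * (r1 - r2) * (r1 - r3)
               * (r2 - r3))) ^+ 2.
Proof.
move=> a_neq0 F4; set rs := [:: r0; r1; r2; r3]; move=> rs_uniq rs_neq0 p.
have size_p : size p = 5%N by rewrite size_scale // size_prod_XsubC.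
have lead_p : lead_coef p = a.
  by rewrite lead_coefZ lead_coef_prod_XsubC mulr1.
have size_p' : size p^`() = 4%N.
  apply/eqP; rewrite eqn_leq -{1}ltnS -{1}size_p lt_size_deriv -?size_poly_gt0 ?size_p //.
  rewrite ltnNge; apply: contra F4 => /leq_sizeP/(_ 3%N (leqnn _))/eqP.
  rewrite coef_deriv; have -> : p`_4 = a by rewrite -lead_p lead_coefE size_p.
  by rewrite -[a *+ 4]mulr_natl mulf_eq0 (negPf a_neq0) orbF.
have deriv_p y : p^`().[y] = a * ((y - r1) * (y - r2) * (y - r3)
    + (y - r0) * (y - r2) * (y - r3) + (y - r0) * (y - r1) * (y - r3)
    + (y - r0) * (y - r1) * (y - r2)).
  rewrite /p /rs !big_cons big_nil mulr1 derivZ !derivM !derivXsubC.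
  rewrite !(mul1r, mulr1) !(hornerZ, hornerD, hornerM, hornerN, hornerX, hornerC).
  ring.
rewrite (@resultant_prod_roots _ _ _ 4 (fun i => nth 0 rs i)).
- rewrite size_p' lead_p !big_ord_recl big_ord0 /= !deriv_p.
  ring.
- by rewrite size_p.
- by rewrite lead_p /p (big_nth 0) big_mkord.
- by move=> i j /eqP; rewrite nth_uniq // => /eqP/val_inj.
by move=> i; apply: contraNneq rs_neq0 => <-; rewrite mem_nth.
Qed.

(** Morphisms from a field preserve degrees, hence the shape of the Sylvester matrix. *)
Lemma map_resultant_field (F : fieldType) (R : nzRingType)
    (h : {rmorphism F -> R}) (p q : {poly F}) :
  h (resultant p q) = resultant (map_poly h p) (map_poly h q).
Proof.
rewrite /resultant /Sylvester_mx !size_map_poly -det_map_mx /= map_col_mx.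
congr (\det (col_mx _ _)); apply: map_lin1_mx => v;
  by rewrite map_poly_rV rmorphM /= map_rVpoly.
Qed.

Theorem corollary2p1
    (f : {poly rat}) (f_irr : irreducible_poly f) (f_deg : size f = 5%N)
    (M : splittingFieldType rat)
    (M_split : splittingFieldFor 1 (map_poly (GRing.in_alg M) f) {:M})
    (f_gal : ('Gal({:M} / 1) \isog [set: 'S_4])%g)
    (x : M) (x_root : root (map_poly (GRing.in_alg M) f) x)
    (sqrtd : M) (sqrtd_sqr : (sqrtd ^+ 2 = (discriminant f)%:A)%R) :
  let E : {subfield M} := <<1 & [:: x; sqrtd]>>%AS in
  [/\ hopf_galois (subvs_of E), \dim E = 8%N
    & ~ almost_classically_galois E].
Proof.
set fM := map_poly (GRing.in_alg M) f in M_split x_root *.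
move=> E.
have f_neq0 : f != 0 by rewrite -size_poly_gt0 f_deg.
have size_fM : size fM = 5%N by rewrite size_map_poly.
have fM_sep : separable_poly fM by rewrite separable_map irreducible_separable.
have galM1 : galois 1 {:M}.
  apply/splitting_galoisField; exists fM; split=> //.
  by apply/polyOver1P; exists f.
have gal1T : 'Gal({:M} / 1)%g = [set: gal_of {:M}].
  by apply/setP=> g; rewrite inE (gal_kAut _ (sub1v _)) kAut1E subvf.
have cardG : #|[set: gal_of {:M}]| = 24%N.
  by rewrite -gal1T (card_isog f_gal) cardsT card_Sn.
have [rs fM_rs rs_gen] := M_split.
have x_rs : x \in rs by rewrite -root_prod_XsubC -(eqp_root fM_rs).
pose rs' := x :: rem x rs.
have rs'_rs : perm_eq rs rs' := perm_to_rem x_rs.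
have rs'_size : size rs' = 4%N.
  apply: succn_inj; rewrite -(perm_size rs'_rs) -size_fM (eqp_size fM_rs).
  by rewrite size_prod_XsubC.
have [r1 [r2 [r3 rs'E]]] : exists r1 r2 r3, rs' = [:: x; r1; r2; r3].
  rewrite /rs' in rs'_size *; case: (rem x rs) rs'_size => [|r1 [|r2 [|r3 []]]] //= _.
  by exists r1, r2, r3.
have fME : fM = lead_coef fM *: \prod_(y <- rs') ('X - y%:P).
  have := eqp_eq fM_rs; rewrite (monicP (monic_prod_XsubC _ _ _)) scale1r.
  by move=> {1}->; rewrite (perm_big _ rs'_rs).
have a_neq0 : lead_coef fM != 0 by rewrite lead_coef_eq0 -size_poly_gt0 size_fM.
have fM_root y : root fM y = (y \in rs').
  by rewrite fME rootZ // root_prod_XsubC.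
have rs'_uniq : uniq rs'.
  rewrite -separable_prod_XsubC -(perm_big _ rs'_rs) /=.
  by rewrite -(eqp_separable fM_rs).
have degree_root y : y \in rs' -> adjoin_degree 1 y = 4%N.
  by rewrite -fM_root => /(irreducible_adjoin_degree f_irr) ->; rewrite f_deg.
(* 0 has degree 1 over the rationals, but the roots have degree 4. *)
have rs'_neq0 : 0 \notin rs'.
  apply/negP => /degree_root/eqP; apply/negP.
  by rewrite (_ : adjoin_degree 1 0 = 1%N) //; apply/eqP; rewrite adjoin_deg_eq1 mem0v.
pose r (i : bool * bool) := match i with
  | (false, false) => x | (true, false) => r1 | (false, true) => r2 | _ => r3 end.
rewrite rs'E in fM_root rs'_uniq rs'_neq0 degree_root fME.
have r_inj : injective r.
  have rE i : r i = nth 0 [:: x; r1; r2; r3] (i.1 + i.2.*2)%N by case: i => -[] [].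
  have i_lt4 (i : bool * bool) : (i.1 + i.2.*2 < 4)%N by case: i => -[] [].
  move=> i j /eqP; rewrite !rE nth_uniq //; do ?exact: i_lt4.
  by case: i j => -[] [] [[] []].
have r_roots y : root fM y -> exists i, y = r i.
  rewrite fM_root !inE => /or4P[] /eqP ->;
  by [exists (false, false) | exists (true, false) | exists (false, true) | exists (true, true)].
have root_r i : root fM (r i).
  by rewrite fM_root; case: i => [[] []]; rewrite /= !inE eqxx ?orbT.
have r_gal (g : gal_of {:M}) i : exists j, g (r i) = r j.
  apply: r_roots; have -> : fM = map_poly g fM.
    rewrite -map_poly_comp; apply: eq_map_poly => c /=.
    by rewrite linearZ /= rmorph1.
  by rewrite fmorph_root root_r.
have r_gen (K : {subfield M}) : (forall i, r i \in K) -> K = {:M}%AS.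
  move=> rK; apply/val_inj/eqP; rewrite eqEsubv subvf /= -rs_gen.
  apply/Fadjoin_seqP; split=> [|y]; first exact: sub1v.
  by rewrite (perm_mem rs'_rs) rs'E -fM_root => /r_roots[i ->].
have deg_x : \dim <<1; x>> = 4%N.
  by rewrite dim_Fadjoin dimv1 degree_root ?inE ?eqxx.
pose a := lead_coef f.
have aE : lead_coef fM = a%:A by rewrite lead_coef_map.
pose delta := (x - r1) * (x - r2) * (x - r3) * (r1 - r2) * (r1 - r3) * (r2 - r3).
have disc : (discriminant f)%:A = (a ^+ 3 *: delta) ^+ 2.
  rewrite /discriminant f_deg -[LHS]/(GRing.in_alg M _) rmorphM rmorphM /=.
  rewrite -[X in _ * X]/(GRing.in_alg M _) map_resultant_field.
  have M4 : 4%:R != 0 :> M.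
    by rewrite -(rmorph_nat (GRing.in_alg M)) fmorph_eq0 pnatr_eq0.
  have := resultant_deriv_quartic a_neq0 M4 rs'_uniq rs'_neq0.
  rewrite /= -fME -deriv_map -/fM => ->.
  rewrite aE -/delta -/a -signr_odd /= expr0 scale1r mul1r mulrA.
  rewrite -scalerAl mul1r scalerA mulVf ?lead_coef_eq0 // scale1r mul1r.
  by rewrite exprZn expr1n -scalerAl mul1r.
(* The choice of square root is absorbed in the sign of b. *)
have [b b_neq0 bE] : exists2 b : rat, b != 0 & sqrtd = b *: delta.
  have /eqP := sqrtd_sqr; rewrite disc eqf_sqr => /orP[] /eqP ->.
    by exists (a ^+ 3); rewrite ?expf_neq0 ?lead_coef_eq0.
  by exists (- a ^+ 3); rewrite ?scaleNr // oppr_eq0 expf_neq0 ?lead_coef_eq0.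
apply: (quartic_compositum galM1 r_inj r_gal r_gen cardG b_neq0 bE) => //.
by exists (discriminant f).
Qed.
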